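(* Let $\Omega\subset\mathbb{R}^3$ be an axisymmetric toroidal domain with analytic boundary. Let $B\in\mathcal{J}^{-1}(\mathcal{U}_{\mathrm{NI}})$, i.e. $B$ is a braided field on $\overline\Omega$ whose $\mu$-preserving Poincaré map $\mathcal{J}(B)$ belongs to $\mathcal{U}_{\mathrm{NI}}$. If there exists a $C^\infty$ volume-preserving diffeomorphism $Y$ of $\overline\Omega$ such that $\bar B:=Y_*B$ is an MHS equilibrium, that is, $$\bar B\times\operatorname{curl}\bar B+\nabla P=0,\qquad \operatorname{div}\bar B=0,\qquad \bar B|_{\partial\Omega}\cdot N=0$$ for some pressure function $P\in C^\infty(\overline\Omega)$, then $$\bar B=c_0V_j+\sum_{k=1}^{d_j}c_k\,v_{j,k}$$ for some integer $j\geq1$ and some real constants $c_0,c_1,\dots,c_{d_j}$.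
   Context: An axisymmetric toroidal domain with analytic boundary is a domain $\Omega\subset\mathbb{R}^3$ with analytic boundary such that $\overline\Omega$ is the body of revolution (around the $x_3$-axis) generated by the closed section $\Sigma:=\overline\Omega\cap\{x_1>0,\ x_2=0\}=\overline\Omega\cap\{\theta=0\}$, where $\Sigma$ is diffeomorphic to the closed unit disk and does not intersect the $x_3$-axis. Here $(r,\theta,z)$ are cylindrical coordinates, $\{\partial_r,\partial_\theta,\partial_z\}$ is the holonomic basis, $B=B^r\partial_r+B^\theta\partial_\theta+B^z\partial_z$, and $N$ is the unit outer normal on $\partial\Omega$. Braided fields: $\mathcal{B}(\overline\Omega):=\{B\in C^\infty(\overline\Omega,\mathbb{R}^3):\operatorname{div}B=0,\ B\cdot N=0\text{ on }\partial\Omega,\ B^\theta>0\text{ on }\overline\Omega\}$, with the $C^\infty$ topology. For $B\in\mathcal{B}(\overline\Omega)$ with flow $\phi^t$, the Poincaré map is $\Pi_B:\Sigma\to\Sigma$, $\Pi_B(x)=\phi^{\tau(x)}x$, with $\tau(x)$ the smallest positive time with $\phi^{\tau(x)}x\in\Sigma$. Let $\mu:=r\,dr\,dz$ on $\Sigma$ and let $\mathrm{Diff}^+_\mu(\Sigma)$ be the group of $C^\infty$ diffeomorphisms of $\Sigma$ preserving $\mu$ and isotopic to the identity, with the $C^\infty$ topology. $\mathcal{J}:\mathcal{B}(\overline\Omega)\to\mathrm{Diff}^+_\mu(\Sigma)$ is a fixed continuous map such that for each $B$ there is a $C^\infty$ diffeomorphism $Y_B$ of $\Sigma$ with $\mathcal{J}(B)=Y_B\circ\Pi_B\circ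 Y_B^{-1}$ (the ''$\mu$-preserving Poincaré map'' of $B$). $\mathcal{U}_{\mathrm{NI}}$ is the set of $F\in\mathrm{Diff}^+_\mu(\Sigma)$ such that (i) $F|_{\partial\Sigma}$ is a Morse--Smale diffeomorphism of $\partial\Sigma\cong\mathbb{S}^1$ (finitely many periodic points, all hyperbolic), and (ii) there is no nonconstant $h\in C^\infty(\Sigma)$ with $h\circ F=h$. Let $h_\Omega:=r^{-2}\partial_\theta$; it spans the (one-dimensional) space of harmonic fields on $\Omega$ tangent to the boundary. The problem $$\operatorname{curl}v=\lambda v\ \text{in }\Omega,\qquad v\cdot N=0\ \text{on }\partial\Omega,\qquad \int_\Omega v\cdot h_\Omega\,dx=0$$ has nontrivial solutions if and only if $\lambda$ belongs to a countable set $\{\lambda_j\}_{j=1}^\infty\subset\mathbb{R}\setminus\{0\}$ without accumulation points (the eigenvalues of curl on $\Omega$). Let $d_j<\infty$ be the dimension of the space of solutions for $\lambda=\lambda_j$ and fix a basis $\{v_{j,1},\dots,v_{j,d_j}\}$ of it. Finally, $V_j$ denotes the unique solution (existence and uniqueness are taken from a cited theorem) of $$\operatorname{curl}V_j=\lambda_jV_j\ \text{in }\Omega,\quad V_j\cdot N=0\ \text{on }\partial\Omega,\quad \int_\Omega V_j\cdot v_{j,k}\,dx=0\ (1\le k\le d_j),\quad \int_\Omega V_j\cdot h_\Omega\,dx=1.$$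
   Formalization: The curl problem includes div v = 0 (without it λ = 0 has nontrivial gradient solutions), and V_j is assumed to be the stated solution only for those j for which one exists, since for some eigenvalues none exists. *)

(* Defs.v *)
From HB Require Import structures.
From mathcomp Require Import all_boot all_order all_algebra.
From mathcomp Require Import all_classical all_reals all_analysis.

Set Implicit Arguments.
Unset Strict Implicit.
Unset Printing Implicit Defensive.

Import Order.TTheory GRing.Theory Num.Theory.
Import numFieldNormedType.Exports.
Local Open Scope classical_set_scope.
Local Open Scope ring_scope.

(* R^n is ['rV[R]_n].  The indices 0, 1, 2 of ['I_3] stand for x1, x2, x3 and
   arithmetic on ['I_3] is modulo 3.  The meridian half-plane {theta = 0} is
   identified with its (r, z) coordinates, so Sigma and its self-maps live in
   ['rV[R]_2], with coordinate 0 = r and coordinate 1 = z.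

   Maps on a subset A are total functions whose values outside A are
   irrelevant.  Equations between derivatives of maps that are smooth up to the
   boundary are written in the open set, where the derivatives do not depend on
   an extension; on the closure they then hold by continuity. *)

(** * Smoothness *)

Fixpoint Ck (R : realType) (V W : normedModType R) (U : set V) (n : nat)
    (f : V -> W) : Prop :=
  match n with
  | 0 => forall x, U x -> {for x, continuous f}
  | n'.+1 => (forall x, U x -> differentiable f x) /\
             (forall v, Ck U n' (fun x => 'D_v f x))
  end.

(* C^oo on an arbitrary set: the restriction of a C^oo map on an open
   neighbourhood. *)
Definition smooth (R : realType) (V W : normedModType R) (A : set V)
    (f : V -> W) : Prop :=
  exists (U : set V) (g : V -> W),
    [/\ open U, A `<=` U, forall n, Ck U n g & forall x, A x -> g x = f x].

Definition diffeo (R : realType) (V W : normedModType R) (A : set V)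
    (B : set W) (f : V -> W) : Prop :=
  smooth A f /\
  exists g : W -> V,
    [/\ smooth B g,
        forall x, A x -> B (f x) /\ g (f x) = x &
        forall y, B y -> A (g y) /\ f (g y) = y].

Definition bdry (T : topologicalType) (A : set T) : set T :=
  closure A `\` interior A.

(** * Vector calculus in R^3 *)

Definition vec2 (R : realType) (a b : R) : 'rV[R]_2 :=
  \row_i nth 0 [:: a; b] i.
Definition vec3 (R : realType) (a b c : R) : 'rV[R]_3 :=
  \row_i nth 0 [:: a; b; c] i.

Definition dot (R : realType) n (u v : 'rV[R]_n) : R :=
  \sum_i u 0 i * v 0 i.

Definition cross (R : realType) (u v : 'rV[R]_3) : 'rV[R]_3 :=
  \row_i (u 0 (i + 1) * v 0 (i + 2) - u 0 (i + 2) * v 0 (i + 1)).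

Definition pd (R : realType) n (W : normedModType R) (i : 'I_n)
    (f : 'rV[R]_n -> W) : 'rV[R]_n -> W :=
  fun x => 'D_(delta_mx 0 i) f x.

Definition grad (R : realType) n (f : 'rV[R]_n -> R) (x : 'rV[R]_n) :
    'rV[R]_n :=
  \row_i pd i f x.

Definition div (R : realType) (F : 'rV[R]_3 -> 'rV[R]_3) (x : 'rV[R]_3) : R :=
  \sum_i pd i (fun y => F y 0 i) x.

Definition curl (R : realType) (F : 'rV[R]_3 -> 'rV[R]_3) (x : 'rV[R]_3) :
    'rV[R]_3 :=
  \row_i (pd (i + 1) (fun y => F y 0 (i + 2)) x -
          pd (i + 2) (fun y => F y 0 (i + 1)) x).

Definition volume_integral (R : realType) (A : set 'rV[R]_3)
    (f : 'rV[R]_3 -> R) : \bar R :=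
  (let lebesgue := @lebesgue_measure R in
   \int[(lebesgue \x lebesgue) \x lebesgue]_(p in
       [set p : (R * R) * R | A (vec3 p.1.1 p.1.2 p.2)])
     (f (vec3 p.1.1 p.1.2 p.2))%:E)%E.

(** * Domains *)

(* Sum of an absolutely convergent triple power series on a polydisc. *)
Definition analytic_at (R : realType) (f : 'rV[R]_3 -> R) (p : 'rV[R]_3) :
    Prop :=
  exists (c : nat -> nat -> nat -> R) (rho M : R),
    [/\ 0 < rho,
        forall N : nat, \sum_(i < N) \sum_(j < N) \sum_(k < N)
          `|c i j k| * rho ^+ (i + j + k) <= M &
        forall x : 'rV[R]_3, (forall i, `|x 0 i - p 0 i| < rho) ->
          (fun N : nat => \sum_(i < N) \sum_(j < N) \sum_(k < N)
             c i j k * (x 0 0 - p 0 0) ^+ i * (x 0 1 - p 0 1) ^+ j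
                     * (x 0 2 - p 0 2) ^+ k) @ \oo --> f x].

(* Near its boundary point p, Omega is the sublevel set {g < 0} of a function
   without critical point at p. *)
Definition defining_function (R : realType) (Omega : set 'rV[R]_3)
    (p : 'rV[R]_3) (g : 'rV[R]_3 -> R) : Prop :=
  grad g p != 0 /\
  exists U : set 'rV[R]_3,
    [/\ open U, U p, forall n, Ck U n g &
        forall x, U x -> (Omega x <-> g x < 0)].

Definition analytic_boundary (R : realType) (Omega : set 'rV[R]_3) : Prop :=
  forall p, bdry Omega p ->
    exists g, defining_function Omega p g /\ analytic_at g p.

Definition outer_unit_normal (R : realType) (Omega : set 'rV[R]_3)
    (p nu : 'rV[R]_3) : Prop :=
  bdry Omega p /\
  exists g, defining_function Omega p g /\
    nu = (Num.sqrt (dot (grad g p) (grad g p)))^-1 *: grad g p.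

Definition tangent_to_boundary (R : realType) (Omega : set 'rV[R]_3)
    (F : 'rV[R]_3 -> 'rV[R]_3) : Prop :=
  forall p nu, outer_unit_normal Omega p nu -> dot (F p) nu = 0.

Definition cyl (R : realType) (r theta z : R) : 'rV[R]_3 :=
  vec3 (r * cos theta) (r * sin theta) z.

Definition embed (R : realType) (s : 'rV[R]_2) : 'rV[R]_3 :=
  vec3 (s 0 0) 0 (s 0 1).

Definition section (R : realType) (Omega : set 'rV[R]_3) : set 'rV[R]_2 :=
  [set s : 'rV[R]_2 | 0 < s 0 0 /\ closure Omega (embed s)].

Definition unit_disk (R : realType) : set 'rV[R]_2 :=
  [set s : 'rV[R]_2 | dot s s <= 1].

(* The section is compact (diffeomorphic to the disk) and lies in {r > 0}, so
   the body of revolution that it generates avoids the x3-axis. *)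
Definition toroidal_domain (R : realType) (Omega : set 'rV[R]_3) : Prop :=
  [/\ open Omega, connected Omega, analytic_boundary Omega,
      (exists f, diffeo (section Omega) (@unit_disk R) f) &
      closure Omega =
        [set x : 'rV[R]_3 | exists (s : 'rV[R]_2) (theta : R),
           section Omega s /\ x = cyl (s 0 0) theta (s 0 1)]].

(* The holonomic field d/dtheta, of length r. *)
Definition d_theta (R : realType) (x : 'rV[R]_3) : 'rV[R]_3 :=
  vec3 (- x 0 1) (x 0 0) 0.

Definition rsq (R : realType) (x : 'rV[R]_3) : R := x 0 0 ^+ 2 + x 0 1 ^+ 2.

(* The component B^theta; the holonomic basis is orthogonal. *)
Definition theta_component (R : realType) (B : 'rV[R]_3 -> 'rV[R]_3)
    (x : 'rV[R]_3) : R :=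
  dot (B x) (d_theta x) / rsq x.

Definition harmonic_field (R : realType) (x : 'rV[R]_3) : 'rV[R]_3 :=
  (rsq x)^-1 *: d_theta x.

(** * Braided fields and Poincare maps *)

Definition braided (R : realType) (Omega : set 'rV[R]_3)
    (B : 'rV[R]_3 -> 'rV[R]_3) : Prop :=
  [/\ smooth (closure Omega) B,
      forall x, Omega x -> div B x = 0,
      tangent_to_boundary Omega B &
      forall x, closure Omega x -> 0 < theta_component B x].

Definition is_flow (R : realType) (Omega : set 'rV[R]_3)
    (B : 'rV[R]_3 -> 'rV[R]_3) (phi : R -> 'rV[R]_3 -> 'rV[R]_3) : Prop :=
  forall x, closure Omega x ->
    phi 0 x = x /\
    forall t : R, closure Omega (phi t x) /\
      is_derive t 1 (fun s : R => phi s x) (B (phi t x)).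

Definition is_poincare_map (R : realType) (Omega : set 'rV[R]_3)
    (B : 'rV[R]_3 -> 'rV[R]_3) (Pi : 'rV[R]_2 -> 'rV[R]_2) : Prop :=
  exists phi, is_flow Omega B phi /\
    forall s, section Omega s ->
      section Omega (Pi s) /\
      exists tau : R,
        [/\ 0 < tau, phi tau (embed s) = embed (Pi s) &
            forall t : R, 0 < t < tau ->
              ~ exists s', section Omega s' /\ phi t (embed s) = embed s'].

(* F^*(r dr dz) = r dr dz. *)
Definition preserves_mu (R : realType) (Sigma : set 'rV[R]_2)
    (F : 'rV[R]_2 -> 'rV[R]_2) : Prop :=
  forall s, interior Sigma s -> F s 0 0 * \det (jacobian F s) = s 0 0.

Definition isotopic_to_id (R : realType) (Sigma : set 'rV[R]_2)
    (F : 'rV[R]_2 -> 'rV[R]_2) : Prop :=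
  exists H : R * 'rV[R]_2 -> 'rV[R]_2,
    [/\ smooth [set p : R * 'rV[R]_2 | 0 <= p.1 <= 1 /\ Sigma p.2] H,
        forall t : R, 0 <= t <= 1 -> diffeo Sigma Sigma (fun s => H (t, s)),
        forall s, Sigma s -> H (0, s) = s &
        forall s, Sigma s -> H (1, s) = F s].

Definition Diff_mu (R : realType) (Sigma : set 'rV[R]_2)
    (F : 'rV[R]_2 -> 'rV[R]_2) : Prop :=
  [/\ diffeo Sigma Sigma F, preserves_mu Sigma F & isotopic_to_id Sigma F].

(* Basic neighbourhoods of the C^oo topology: all partial derivatives of order
   at most k differ by at most e.  The sets A of interest are the closure of
   their interior, so suprema over the interior are suprema over A. *)
Definition Ck_close (R : realType) n m (A : set 'rV[R]_n) (k : nat) (e : R)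
    (f g : 'rV[R]_n -> 'rV[R]_m) : Prop :=
  forall s : seq 'I_n, (size s <= k)%N -> forall x, interior A x ->
    `|foldr (fun i h => pd i h) f s x - foldr (fun i h => pd i h) g s x| <= e.

Definition mu_preserving_poincare (R : realType) (Omega : set 'rV[R]_3)
    (J : ('rV[R]_3 -> 'rV[R]_3) -> ('rV[R]_2 -> 'rV[R]_2)) : Prop :=
  [/\ forall B, braided Omega B -> Diff_mu (section Omega) (J B),
      forall B, braided Omega B -> forall (k : nat) (e : R), 0 < e ->
        exists (m : nat) (d : R), 0 < d /\
          forall B', braided Omega B' -> Ck_close (closure Omega) m d B B' ->
            Ck_close (section Omega) k e (J B) (J B') &
      forall B, braided Omega B ->
        exists YB Pi, [/\ diffeo (section Omega) (section Omega) YB,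
          is_poincare_map Omega B Pi &
          forall s, section Omega s -> J B (YB s) = YB (Pi s)]].

(* For a circle diffeomorphism, p is a hyperbolic fixed point of F^n when the
   eigenvalue of its derivative along the boundary has modulus <> 1; tangent
   vectors are represented by curves in the boundary. *)
Definition boundary_morse_smale (R : realType) (Sigma : set 'rV[R]_2)
    (F : 'rV[R]_2 -> 'rV[R]_2) : Prop :=
  finite_set [set p | bdry Sigma p /\ exists n, iter n.+1 F p = p] /\
  forall p n, bdry Sigma p -> iter n.+1 F p = p ->
    forall (gamma : R -> 'rV[R]_2) (l : R),
      smooth setT gamma -> (forall t, bdry Sigma (gamma t)) ->
      gamma 0 = p -> derive1 gamma 0 != 0 ->
      derive1 (fun t => iter n.+1 F (gamma t)) 0 = l *: derive1 gamma 0 ->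
      `|l| != 1.

Definition U_NI (R : realType) (Sigma : set 'rV[R]_2)
    (F : 'rV[R]_2 -> 'rV[R]_2) : Prop :=
  [/\ Diff_mu Sigma F,
      boundary_morse_smale Sigma F &
      ~ exists h : 'rV[R]_2 -> R,
          [/\ smooth Sigma h, forall s, Sigma s -> h (F s) = h s &
              exists s s', [/\ Sigma s, Sigma s' & h s != h s']]].

(** * Eigenfields of curl *)

(* div v = 0 follows from the curl equation when l != 0; for l = 0 it is needed
   to exclude gradient fields, which would make 0 an eigenvalue below. *)
Definition beltrami (R : realType) (Omega : set 'rV[R]_3) (l : R)
    (v : 'rV[R]_3 -> 'rV[R]_3) : Prop :=
  [/\ smooth (closure Omega) v,
      forall x, Omega x -> curl v x = l *: v x,
      forall x, Omega x -> div v x = 0 &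
      tangent_to_boundary Omega v].

Definition inner_product (R : realType) (Omega : set 'rV[R]_3)
    (v w : 'rV[R]_3 -> 'rV[R]_3) : \bar R :=
  volume_integral Omega (fun x => dot (v x) (w x)).

Definition curl_eigenfield (R : realType) (Omega : set 'rV[R]_3) (l : R)
    (v : 'rV[R]_3 -> 'rV[R]_3) : Prop :=
  beltrami Omega l v /\ inner_product Omega v (@harmonic_field R) = 0%:E.

Definition curl_spectrum (R : realType) (Omega : set 'rV[R]_3)
    (lambda : nat -> R) : Prop :=
  [/\ forall j, lambda j != 0,
      limit_point (range lambda) = set0 &
      forall l : R,
        (exists v, curl_eigenfield Omega l v /\
                   exists x, Omega x /\ v x != 0) <->
        (exists j, l = lambda j)].

Definition eigenbasis (R : realType) (Omega : set 'rV[R]_3) (l : R) (d : nat)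
    (v : 'I_d -> 'rV[R]_3 -> 'rV[R]_3) : Prop :=
  [/\ forall k, curl_eigenfield Omega l (v k),
      forall w, curl_eigenfield Omega l w ->
        exists c : 'I_d -> R,
          forall x, closure Omega x -> w x = \sum_k c k *: v k x &
      forall c : 'I_d -> R,
        (forall x, closure Omega x -> \sum_k c k *: v k x = 0) ->
        forall k, c k = 0].

(* For an eigenvalue l with eigenbasis v, a solution is unique, but it need
   not exist: integrating V . curl v - v . curl V over Omega shows that every
   eigenfield v for l must have vanishing circulation along the toroidal
   boundary cycles. *)
Definition unit_flux_solution (R : realType) (Omega : set 'rV[R]_3) (l : R)
    (d : nat) (v : 'I_d -> 'rV[R]_3 -> 'rV[R]_3)
    (V : 'rV[R]_3 -> 'rV[R]_3) : Prop :=
  [/\ beltrami Omega l V,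
      forall k, inner_product Omega V (v k) = 0%:E &
      inner_product Omega V (@harmonic_field R) = 1%:E].

(** * Equilibria *)

Definition volume_preserving_diffeo (R : realType) (Omega : set 'rV[R]_3)
    (Y : 'rV[R]_3 -> 'rV[R]_3) : Prop :=
  diffeo (closure Omega) (closure Omega) Y /\
  forall x, Omega x -> `|\det (jacobian Y x)| = 1.

(* Bb = Y_* B. *)
Definition field_pushforward (R : realType) (Omega : set 'rV[R]_3)
    (Y B Bb : 'rV[R]_3 -> 'rV[R]_3) : Prop :=
  smooth (closure Omega) Bb /\
  forall x, Omega x -> Bb (Y x) = 'D_(B x) Y x.

Definition mhs_equilibrium (R : realType) (Omega : set 'rV[R]_3)
    (B : 'rV[R]_3 -> 'rV[R]_3) : Prop :=
  [/\ exists P : 'rV[R]_3 -> R, smooth (closure Omega) P /\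
        forall x, Omega x -> cross (B x) (curl B x) + grad P x = 0,
      forall x, Omega x -> div B x = 0 &
      tangent_to_boundary Omega B].

(* Main.v *)
Require Import Defs.
From mathcomp Require Import all_boot all_order all_algebra.
From mathcomp Require Import ring lra.
From mathcomp Require Import all_classical all_reals all_analysis.
Import Order.TTheory GRing.Theory Num.Theory.
Import numFieldNormedType.Exports.
Local Open Scope classical_set_scope.
Local Open Scope ring_scope.
Set Implicit Arguments. Unset Strict Implicit. Unset Printing Implicit Defensive.

(** By the equilibrium equation, Bbar . grad P = 0: the pressure is a first
    integral of Bbar, and P o Y is one of B. A first integral of B restricts to a
    function on the section that is invariant under the Poincare map, and
    conjugation by Y_B makes it invariant under J(B). Such functions are
    constant by hypothesis, and every orbit of B meets the section because
    B^theta > 0. Hence Bbar has only constant first integrals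
    ([pushforward_first_integral_constant]).

    This applies to P, so that Bbar x curl Bbar = 0, and then to the factor in
    curl Bbar = f Bbar, which is a first integral because both fields are
    divergence free. Thus curl Bbar = l Bbar for a constant l
    ([mhs_beltrami]).

    The symmetry of the domain makes l an eigenvalue ([beltrami_eigenvalue]).
    If it were not one, then a Beltrami field for l would be determined by its
    flux, its inner product with the harmonic field h, and all such fields would
    be multiples of Bbar. When l = 0, this holds for h. When l is not 0, it
    holds for the rotated fields of Bbar; the multiple is 1, so Bbar is
    axisymmetric, and the gradient of Bbar . d/dtheta is l times
    d/dtheta x Bbar. So Bbar . d/dtheta is a first integral, hence constant, and
    Bbar is parallel to d/dtheta. In both cases r^2 is a nonconstant first
    integral of Bbar, a contradiction.

    For an eigenvalue l, a multiple of the unit-flux solution removes the flux of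
    Bbar, and the difference is an eigenfield ([eigenvalue_decomposition]). *)

(** * Calculus of C^n maps *)

Section calculus.
Variable R : realType.
Implicit Types V W : normedModType R.

(** The first-order expansion of f at x is one of g, so that the differential of
    f is that of g by uniqueness. *)
Lemma near_eq_differentiable V W (f g : V -> W) (x : V) :
  (\near x, f x = g x) -> differentiable f x -> differentiable g x.
Proof.
move=> fg df.
have dfx := diff_locally df.
have gE : g \o shift x = cst (g x) + 'd f x +o_0 id.
  have /eqaddoP fo := dfx; apply/eqaddoP => e e0.
  have := fo e e0 => {fo} fo.
  have fgx : f x = g x by exact: nbhs_singleton fg.
  have fg0 : \forall y \near (0 : V), f (y + x) = g (y + x).
    by move: fg; rewrite (near_shift 0 x) /=; apply: filterS => y /=;
      rewrite subr0.
  near=> y.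
  have : `|(f \o shift x - (cst (f x) + 'd f x)) y| <= e * `|id y|.
    by near: y.
  rewrite /= !fctE /=.
  have -> : f (y + x) = g (y + x) by near: y.
  by rewrite fgx.
have dfc : continuous ('d f x) by exact: diff_continuous.
have dE := diff_unique dfc gE.
apply/diff_locallyP; rewrite dE; split => //.
Unshelve. all: by end_near. Qed.

Lemma open_near_eq V W (U : set V) (f g : V -> W) (x : V) :
  open U -> U x -> (forall y, U y -> f y = g y) -> \near x, f x = g x.
Proof.
by move=> oU Ux fg; near=> y; apply: fg; near: y; exact: open_nbhs_nbhs.
Unshelve. all: by end_near. Qed.

Lemma Ck_sub V W (U U' : set V) n (f : V -> W) :
  U' `<=` U -> Ck U n f -> Ck U' n f.
Proof.
move=> sU; elim: n f => [|n IH] f /=; first by move=> h x /sU/h.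
by move=> [d h]; split=> [x /sU/d//|v]; apply: IH.
Qed.

Lemma Ck_ext V W (U : set V) n (f g : V -> W) : open U ->
  (forall x, U x -> f x = g x) -> Ck U n f -> Ck U n g.
Proof.
move=> oU; elim: n f g => [|n IH] f g fg /=.
  move=> h x Ux; have := h x Ux.
  rewrite /prop_for /continuous_at -(fg x Ux); apply: cvg_trans.
  apply: near_eq_cvg; exact: (open_near_eq oU).
move=> [d h]; split=> [x Ux|v].
  apply: near_eq_differentiable (d x Ux); exact: (open_near_eq oU).
apply: IH (h v) => x Ux.
by apply: near_eq_derive; exact: (open_near_eq oU).
Qed.

Lemma CkS V W (U : set V) n (f : V -> W) : Ck U n.+1 f -> Ck U n f.
Proof.
elim: n f => [|n IH] f.
  by move=> [d _] x /d; exact: differentiable_continuous.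
by move=> [d h]; split => // v; apply: IH; apply: h.
Qed.

Lemma Ck_cst V W (U : set V) n (c : W) : Ck U n (fun=> c).
Proof.
elim: n c => [|n IH] c /=; first by move=> x _; apply: cst_continuous.
split=> [x _|v]; first exact: differentiable_cst.
have -> : (fun x : V => 'D_v (fun=> c) x) = (fun=> 0 : W).
  by apply/funext => x; rewrite derive_cst.
exact: IH.
Qed.

Lemma CkD V W (U : set V) n (f g : V -> W) : open U ->
  Ck U n f -> Ck U n g -> Ck U n (fun x => f x + g x).
Proof.
move=> oU; elim: n f g => [|n IH] f g /=.
  by move=> cf cg x Ux; apply: continuousD; [exact: cf|exact: cg].
move=> [df hf] [dg hg]; split=> [x Ux|v].
  by apply: differentiableD; [exact: df|exact: dg].
apply: Ck_ext (IH _ _ (hf v) (hg v)) => // x Ux.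
by rewrite deriveD//; apply: diff_derivable; (exact: df || exact: dg).
Qed.

Lemma CkM V (U : set V) n (f g : V -> R) : open U ->
  Ck U n f -> Ck U n g -> Ck U n (fun x => f x * g x).
Proof.
move=> oU; elim: n f g => [|n IH] f g.
  by move=> cf cg x Ux; apply: continuousM; [exact: cf|exact: cg].
move=> kf kg; have [df hf] := kf; have [dg hg] := kg; split=> [x Ux|v].
  by apply: differentiableM; [exact: df|exact: dg].
have k1 := IH _ _ (CkS kf) (hg v); have k2 := IH _ _ (hf v) (CkS kg).
apply: Ck_ext (CkD oU k1 k2) => // x Ux.
rewrite deriveM; [|by apply: diff_derivable; (exact: df || exact: dg)..].
by rewrite [X in _ = _ + X]mulrC.
Qed.

Lemma CkN V (U : set V) n (f : V -> R) : open U ->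
  Ck U n f -> Ck U n (fun x => - f x).
Proof.
move=> oU kf; apply: Ck_ext (CkM oU (Ck_cst (W := R) U n (-1)) kf) => // x _.
by rewrite mulN1r.
Qed.

Lemma Ck_sum V W (U : set V) n (I : Type) (s : seq I) (F : I -> V -> W) :
  open U -> (forall i, Ck U n (F i)) -> Ck U n (fun x => \sum_(i <- s) F i x).
Proof.
move=> oU kF; elim: s => [|i s IH].
  by apply: Ck_ext (Ck_cst (W := W) U n 0) => // x _; rewrite big_nil.
by apply: Ck_ext (CkD oU (kF i) IH) => // x _; rewrite big_cons.
Qed.

(** The derivative of 1/f is - (1/f)^2 D_v f, which the induction hypothesis
    covers. *)
Lemma CkV V (U : set V) n (f : V -> R) : open U ->
  (forall x, U x -> f x != 0) -> Ck U n f -> Ck U n (fun x => (f x)^-1).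
Proof.
move=> oU f0; elim: n => [|n IH].
  by move=> cf x Ux; apply: continuousV; [exact: f0|exact: cf].
move=> kf; have [df hf] := kf; split=> [x Ux|v].
  by apply: differentiableV; [exact: df|exact: f0].
have kV := IH (CkS kf).
apply: Ck_ext (CkN oU (CkM oU (CkM oU kV kV) (hf v))) => // x Ux.
rewrite deriveV; [|exact: f0|by apply: diff_derivable; exact: df].
by rewrite /GRing.scale /= mulNr expr2 invfM.
Qed.

Lemma differentiable_rVP V m (f : V -> 'rV[R]_m) (x : V) :
  differentiable f x <-> forall i, differentiable (fun y => f y 0 i) x.
Proof.
split=> [df i|df].
  apply: (@differentiable_comp _ _ _ _ f (fun M : 'rV[R]_m => M 0 i)) => //.
  exact: differentiable_coord.
have -> : f = \sum_(i < m) (fun y => f y 0 i *: 'e_i).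
  by apply/funext => y; rewrite {1}[f y]row_sum_delta fct_sumE.
by apply: differentiable_sum => i; apply: differentiableZl.
Qed.

Lemma derive_rV V m (f : V -> 'rV[R]_m) (v x : V) i :
  differentiable f x -> ('D_v f x) 0 i = 'D_v (fun y => f y 0 i) x.
Proof. by move=> df; rewrite derive_mx ?mxE//; exact: diff_derivable. Qed.

(** Neighbourhoods of a row vector contain products of neighbourhoods of its
    finitely many coordinates. *)
Lemma continuous_rV (T : topologicalType) m (f : T -> 'rV[R]_m) (x : T) :
  (forall i, {for x, continuous (fun y => f y 0 i)}) -> {for x, continuous f}.
Proof.
move=> cf A [P nP PA].
have : \forall y \near x, forall j, P 0 j (f y 0 j).
  by apply: filter_forall => j; apply: (cf j); exact: nP.
by apply: filterS => y Py; apply: PA => i j; rewrite (ord1 i); exact: Py.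
Qed.

Lemma Ck_rVP V m (U : set V) n (f : V -> 'rV[R]_m) : open U ->
  Ck U n f <-> forall i, Ck U n (fun x => f x 0 i).
Proof.
move=> oU; elim: n f => [|n IH] f.
  split=> [cf i x Ux|cf x Ux].
    apply: (@continuous_comp _ _ _ f (fun M : 'rV[R]_m => M 0 i)).
      exact: cf.
    exact: coord_continuous.
  by apply: continuous_rV => i; exact: cf.
split=> [[df hf] i|kf].
  split=> [x /df/differentiable_rVP//|v].
  have /(IH _) /(_ i) := hf v.
  by apply: Ck_ext => // x /df dx; rewrite derive_rV.
have df x : U x -> differentiable f x.
  by move=> Ux; apply/differentiable_rVP => i; have [d _] := kf i; exact: d.
split=> // v; apply/IH => i; have [_ h] := kf i.
by apply: Ck_ext (h v) => // x /df dx; rewrite derive_rV.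
Qed.

Lemma derive_comp V V' W (f : V -> V') (g : V' -> W) (v x : V) :
  differentiable f x -> differentiable g (f x) ->
  'D_v (g \o f) x = 'D_('D_v f x) g (f x).
Proof.
move=> df dg; rewrite !deriveE//; first by rewrite diff_comp.
exact: differentiable_comp.
Qed.

Lemma derive_dot_grad n (g : 'rV[R]_n -> R) (v x : 'rV[R]_n) :
  differentiable g x -> 'D_v g x = dot v (grad g x).
Proof.
move=> dg; rewrite deriveE// {1}[v]row_sum_delta linear_sum /dot.
by apply: eq_bigr => i _; rewrite linearZ /= mxE /pd -deriveE.
Qed.

(** The chain rule D_v (g o f) = D_(D_v f) g evaluates g along a moving
    direction; written as the finite sum of the (D_v f)_i * (d_i g o f) it only
    involves maps of class C^n. *)
Lemma Ck_comp V m (U : set V) (U' : set 'rV[R]_m) n (f : V -> 'rV[R]_m)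
    (g : 'rV[R]_m -> R) : open U -> (forall x, U x -> U' (f x)) ->
  Ck U n f -> Ck U' n g -> Ck U n (fun x => g (f x)).
Proof.
move=> oU fU; elim: n g => [|n IH] g.
  move=> cf cg x Ux; apply: (@continuous_comp _ _ _ f g); first exact: cf.
  by apply: cg; exact: fU.
move=> kf kg; have [df hf] := kf; have [dg hg] := kg; split=> [x Ux|v].
  apply: (@differentiable_comp _ _ _ _ f g); first exact: df.
  by apply: dg; exact: fU.
have key : Ck U n (fun x => \sum_(i < m) ('D_v f x) 0 i * 'D_('e_i) g (f x)).
  apply: Ck_sum => // i; apply: CkM => //.
    exact: (proj1 (Ck_rVP n _ oU) (hf v) i).
  exact: (IH ('D_('e_i) g) (CkS kf) (hg _)).
apply: Ck_ext key => // x Ux.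
rewrite (@derive_comp _ _ _ f g); [|exact: df|by apply: dg; exact: fU].
rewrite derive_dot_grad; last by apply: dg; exact: fU.
by rewrite /dot; apply: eq_bigr => i _; rewrite mxE.
Qed.

Lemma derive_coord m (v : 'rV[R]_m) i (x : 'rV[R]_m) :
  'D_v (fun y : 'rV[R]_m => y 0 i) x = v 0 i.
Proof.
have did : differentiable (id : 'rV[R]_m -> 'rV[R]_m) x.
  by apply/differentiable_rVP => j; exact: differentiable_coord.
by have := derive_rV v i did; rewrite derive_id.
Qed.

Lemma Ck_coord m (U : set 'rV[R]_m) n (i : 'I_m) :
  Ck U n (fun x : 'rV[R]_m => x 0 i).
Proof.
case: n => [|n]; first by move=> x _; exact: coord_continuous.
split=> [x _|v]; first exact: differentiable_coord.
suff -> : (fun x : 'rV[R]_m => 'D_v (fun y : 'rV[R]_m => y 0 i) x) =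
          (fun=> v 0 i) by exact: Ck_cst.
by apply/funext => x; rewrite derive_coord.
Qed.

End calculus.

(** * Smooth maps on arbitrary sets *)

Section smooth_maps.
Variable R : realType.
Implicit Types V W : normedModType R.

(** Extensions of smooth maps are composed, or inverted, on open sets of this
    form. *)
Lemma open_setI_preim (T T' : topologicalType) (U : set T) (U' : set T')
    (f : T -> T') : open U -> open U' ->
  (forall x, U x -> {for x, continuous f}) -> open (U `&` f @^-1` U').
Proof.
move=> oU oU' cf; rewrite openE => x [Ux fx]; rewrite /interior.
apply: filterI; first exact: open_nbhs_nbhs.
by apply: (cf x Ux); exact: open_nbhs_nbhs.
Qed.

Lemma smooth_Ck V W (A U : set V) (f : V -> W) n : open U -> U `<=` A ->
  smooth A f -> Ck U n f.
Proof.
move=> oU UA [U' [g [oU' AU' kg gf]]].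
by apply: Ck_ext (Ck_sub _ (kg n)) => // x /UA; [exact: gf|exact: AU'].
Qed.

Lemma smooth_differentiable V W (A U : set V) (f : V -> W) x :
  open U -> U `<=` A -> U x -> smooth A f -> differentiable f x.
Proof. by move=> oU UA Ux /(smooth_Ck 1 oU UA) [d _]; exact: d. Qed.

Lemma smooth_ext V W (A : set V) (f f' : V -> W) :
  (forall x, A x -> f x = f' x) -> smooth A f -> smooth A f'.
Proof.
move=> ff' [U [g [oU AU kg gf]]]; exists U, g; split=> // x Ax.
by rewrite gf// ff'.
Qed.

Lemma smooth_cst V W (A : set V) (c : W) : smooth A (fun=> c).
Proof.
by exists setT, (fun=> c); split=> //; [exact: openT|move=> n; exact: Ck_cst].
Qed.

Lemma smooth_coord m (A : set 'rV[R]_m) i : smooth A (fun x : 'rV[R]_m => x 0 i).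
Proof.
exists setT, (fun x : 'rV[R]_m => x 0 i).
by split=> //; [exact: openT|move=> n; exact: Ck_coord].
Qed.

Lemma smoothD V W (A : set V) (f g : V -> W) :
  smooth A f -> smooth A g -> smooth A (fun x => f x + g x).
Proof.
move=> [U [f' [oU AU kf ff]]] [U' [g' [oU' AU' kg gg]]].
exists (U `&` U'), (fun x => f' x + g' x); split.
- exact: openI.
- by move=> x Ax; split; [exact: AU|exact: AU'].
- move=> n; apply: CkD; first exact: openI.
    by apply: Ck_sub (kf n) => x [].
  by apply: Ck_sub (kg n) => x [].
- by move=> x Ax; rewrite ff// gg.
Qed.

Lemma smoothM V (A : set V) (f g : V -> R) :
  smooth A f -> smooth A g -> smooth A (fun x => f x * g x).
Proof.
move=> [U [f' [oU AU kf ff]]] [U' [g' [oU' AU' kg gg]]].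
exists (U `&` U'), (fun x => f' x * g' x); split.
- exact: openI.
- by move=> x Ax; split; [exact: AU|exact: AU'].
- move=> n; apply: CkM; first exact: openI.
    by apply: Ck_sub (kf n) => x [].
  by apply: Ck_sub (kg n) => x [].
- by move=> x Ax; rewrite ff// gg.
Qed.

Lemma smoothN V (A : set V) (f : V -> R) :
  smooth A f -> smooth A (fun x => - f x).
Proof.
move=> sf; have := smoothM (smooth_cst A (- 1 : R^o)) sf.
by apply: smooth_ext => x _; rewrite mulN1r.
Qed.

Lemma smoothV V (A : set V) (f : V -> R) : (forall x, A x -> f x != 0) ->
  smooth A f -> smooth A (fun x => (f x)^-1).
Proof.
move=> f0 [U [g [oU AU kg gf]]].
exists (U `&` g @^-1` [set y | y != 0]), (fun x => (g x)^-1).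
have oU' : open (U `&` g @^-1` [set y : R | y != 0]).
  by apply: open_setI_preim (kg 0).
split=> //.
- move=> x Ax; split; first exact: AU.
  by rewrite /= gf//; exact: f0.
- move=> n; apply: CkV => //; first by move=> x [].
  by apply: Ck_sub (kg n) => x [].
- by move=> x Ax; rewrite gf.
Qed.

Lemma smooth_sum V W (A : set V) (I : Type) (s : seq I) (F : I -> V -> W) :
  (forall i, smooth A (F i)) -> smooth A (fun x => \sum_(i <- s) F i x).
Proof.
move=> kF; elim: s => [|i s IH].
  by apply: smooth_ext (smooth_cst (W := W) A 0) => // x _; rewrite big_nil.
by apply: smooth_ext (smoothD (kF i) IH) => // x _; rewrite big_cons.
Qed.

(** The coordinates may extend to different neighbourhoods of A; there are
    finitely many of them, and the interior of the intersection still contains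
    A. *)
Lemma smooth_rVP V m (A : set V) (f : V -> 'rV[R]_m) :
  smooth A f <-> forall i, smooth A (fun x => f x 0 i).
Proof.
split.
  move=> [U [g [oU AU kg gf]]] i; exists U, (fun x => g x 0 i); split=> //.
    by move=> n; exact: (proj1 (Ck_rVP n g oU) (kg n) i).
  by move=> x Ax; rewrite gf.
move=> sf.
have ex i : {Ug : set V * (V -> R) | [/\ open Ug.1, A `<=` Ug.1,
    forall n, Ck Ug.1 n Ug.2 & forall x, A x -> Ug.2 x = f x 0 i]}.
  by apply: cid; have [U [g h]] := sf i; exists (U, g).
pose U := [set x | forall i, (sval (ex i)).1 x]°.
have UE x i : U x -> (sval (ex i)).1 x by move=> /interior_subset; exact.
exists U, (fun x => \row_i (sval (ex i)).2 x); split.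
- exact: open_interior.
- move=> x Ax; apply: filter_forall => i; apply: open_nbhs_nbhs; split.
    by have [] := svalP (ex i).
  by have [_ + _ _] := svalP (ex i); apply.
- move=> n; apply/Ck_rVP; first exact: open_interior.
  move=> i; have [_ _ kg _] := svalP (ex i).
  apply: Ck_ext (Ck_sub _ (kg n)); first exact: open_interior.
    by move=> x _; rewrite mxE.
  by move=> x /UE.
- move=> x Ax; apply/rowP => i; rewrite mxE.
  by have [_ _ _] := svalP (ex i); apply.
Qed.

Lemma smooth_comp V m (A : set V) (A' : set 'rV[R]_m) (f : V -> 'rV[R]_m)
    (g : 'rV[R]_m -> R) : (forall x, A x -> A' (f x)) ->
  smooth A f -> smooth A' g -> smooth A (fun x => g (f x)).
Proof.
move=> fA [U [f' [oU AU kf ff]]] [U' [g' [oU' AU' kg gg]]].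
have oI : open (U `&` f' @^-1` U').
  by apply: open_setI_preim => //; exact: (kf 0).
exists (U `&` f' @^-1` U'), (fun x => g' (f' x)); split=> //.
- by move=> x Ax; split; [exact: AU|rewrite /= ff//; apply: AU'; exact: fA].
- move=> n; apply: (Ck_comp oI _ _ (kg n)); first by move=> x [].
  by apply: Ck_sub (kf n) => x [].
- by move=> x Ax; rewrite ff// gg//; exact: fA.
Qed.

Lemma smooth_comp_rV V m p (A : set V) (A' : set 'rV[R]_m) (f : V -> 'rV[R]_m)
    (g : 'rV[R]_m -> 'rV[R]_p) : (forall x, A x -> A' (f x)) ->
  smooth A f -> smooth A' g -> smooth A (fun x => g (f x)).
Proof.
move=> fA sf /smooth_rVP sg; apply/smooth_rVP => i.
exact: smooth_comp (sg i).
Qed.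

Lemma smooth_dot V m (A : set V) (f g : V -> 'rV[R]_m) :
  smooth A f -> smooth A g -> smooth A (fun x => dot (f x) (g x)).
Proof.
move=> /smooth_rVP sf /smooth_rVP sg.
by apply: smooth_sum => i; exact: smoothM.
Qed.

Lemma smoothZ V m (A : set V) (a : V -> R) (f : V -> 'rV[R]_m) :
  smooth A a -> smooth A f -> smooth A (fun x => a x *: f x).
Proof.
move=> sa /smooth_rVP sf; apply/smooth_rVP => i.
by apply: smooth_ext (smoothM sa (sf i)) => x _; rewrite mxE.
Qed.

(** This is how equations that hold in the open domain reach its boundary, where
    derivatives are those of a smooth extension. *)
Lemma eq_on_closure (T T' : topologicalType) (A : set T) (f g : T -> T') x :
  hausdorff_space T' -> closure A x ->
  {for x, continuous f} -> {for x, continuous g} ->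
  (forall y, A y -> f y = g y) -> f x = g x.
Proof.
move=> hT Ax cf cg fg; apply: hT => P Q nP nQ.
have nfg : nbhs x (f @^-1` P `&` g @^-1` Q).
  by apply: filterI; [exact: cf|exact: cg].
have [y [Ay [Py Qy]]] := Ax _ nfg.
by exists (f y); split=> //; rewrite fg.
Qed.

End smooth_maps.

(** * Symmetry of second derivatives *)

Section schwarz.
Variable R : realType.
Implicit Types V W : normedModType R.

Lemma is_derive_path V W (g : R -> V) (dg : V) (f : V -> W) (t : R) :
  is_derive t 1 g dg -> differentiable f (g t) ->
  is_derive t 1 (fun s => f (g s)) ('D_dg f (g t)).
Proof.
move=> [dgt gE] df.
have dgt' : differentiable g t by exact/derivable1_diffP.
have dc : differentiable (f \o g) t by exact: differentiable_comp.
apply: DeriveDef; first exact: diff_derivable.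
by have := derive_comp (1 : R^o) dgt' df; rewrite gE.
Qed.

Lemma is_derive_line V (x v : V) (t : R) :
  is_derive t 1 (fun s : R => x + s *: v) v.
Proof.
have dl : differentiable (fun s : R => s *: v) t.
  by apply: (@differentiableZl _ _ _ id).
have -> : (fun s : R => x + s *: v) = cst x + (fun s : R => s *: v) by [].
apply: DeriveDef.
  apply: derivableD; first exact: derivable_cst.
  exact: diff_derivable.
rewrite deriveD; [|exact: derivable_cst|exact: diff_derivable].
rewrite derive_cst add0r deriveE//.
by rewrite diff_val scale1r.
Qed.

Lemma MVT_line V (f : V -> R) (x v : V) (s : R) : 0 < s ->
  (forall t, 0 <= t <= s -> differentiable f (x + t *: v)) ->
  exists2 t, 0 <= t <= s & f (x + s *: v) - f x = s * 'D_v f (x + t *: v).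
Proof.
move=> s0 df.
have dft t : 0 <= t <= s ->
    is_derive t 1 (fun t => f (x + t *: v)) ('D_v f (x + t *: v)).
  by move=> /df; apply: is_derive_path; exact: is_derive_line.
have [t||t] := @MVT R (fun t => f (x + t *: v)) (fun t => 'D_v f (x + t *: v))
   0 s s0.
- by rewrite in_itv /= => /andP[t0 ts]; apply: dft; rewrite !ltW.
- apply: derivable_within_continuous => t; rewrite in_itv /= => ts.
  by have [] := dft t ts.
- rewrite in_itv /= => /andP[t0 ts]; rewrite scale0r addr0 subr0 => ->.
  by exists t; [rewrite !ltW|rewrite mulrC].
Qed.

(** Two applications of the mean value theorem, first to
    y |-> g (y + s w) - g y along v, then to D_v g along w. *)
Lemma second_difference V (g : V -> R) (U : set V) (x v w : V) (s : R) :
  0 < s -> Ck U 2 g ->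
  (forall a b, 0 <= a <= s -> 0 <= b <= s -> U (x + a *: v + b *: w)) ->
  exists a b, [/\ 0 <= a <= s, 0 <= b <= s &
    g (x + s *: v + s *: w) - g (x + s *: v) - (g (x + s *: w) - g x) =
    s * (s * 'D_w ('D_v g) (x + a *: v + b *: w))].
Proof.
move=> s0 [dg /(_ v) [dgv _]] inU.
have s00 : 0 <= s <= s by rewrite lexx ltW.
have z00 : 0 <= (0 : R) <= s by rewrite lexx ltW.
pose f := fun y : V => g (y + s *: w) - g y.
have di y : differentiable (fun y : V => y + s *: w) y.
  by apply: (@differentiableD _ _ _ id (cst (s *: w))).
have dsh y : differentiable g (y + s *: w) ->
    differentiable (fun y => g (y + s *: w)) y.
  by move=> d; apply: (@differentiable_comp _ _ _ _ (fun y => y + s *: w) g).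
have shE y : differentiable g (y + s *: w) ->
    'D_v (fun y => g (y + s *: w)) y = 'D_v g (y + s *: w).
  move=> d.
  rewrite (@derive_comp _ _ _ _ (fun y => y + s *: w) g)//.
  have -> : 'D_v (fun y' : V => y' + s *: w) y = v; last by [].
  rewrite (@deriveD _ _ _ id (cst (s *: w))); first last.
  - exact: derivable_cst.
  - exact: derivable_id.
  by rewrite derive_id derive_cst addr0.
have dgs a : 0 <= a <= s -> differentiable g (x + a *: v + s *: w).
  by move=> as_; apply: dg; exact: inU.
have dg0 a : 0 <= a <= s -> differentiable g (x + a *: v).
  by move=> as_; apply: dg; have := inU a 0 as_ z00; rewrite scale0r addr0.
have [a as_ aE] : exists2 a, 0 <= a <= s &
    f (x + s *: v) - f x = s * 'D_v f (x + a *: v).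
  apply: MVT_line => // t ts; apply: differentiableB; last exact: dg0.
  by apply: dsh; exact: dgs.
have [b bs bE] : exists2 b, 0 <= b <= s &
    'D_v g (x + a *: v + s *: w) - 'D_v g (x + a *: v) =
    s * 'D_w ('D_v g) (x + a *: v + b *: w).
  by apply: (@MVT_line V ('D_v g) _ w s s0) => t ts; apply: dgv; exact: inU.
exists a, b; split=> //; rewrite -bE -[LHS]/(f (x + s *: v) - f x) aE.
congr (_ * _).
rewrite (@deriveB _ _ _ (fun y => g (y + s *: w)) g).
- by rewrite shE//; exact: dgs.
- by apply: diff_derivable; apply: dsh; exact: dgs.
- by apply: diff_derivable; exact: dg0.
Qed.

(** The second difference is symmetric in v and w, so that [second_difference]
    equates values of the two mixed derivatives at two points that tend to x
    with s. *)
Lemma derive_sym V (g : V -> R) (U : set V) (x v w : V) : open U -> U x ->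
  Ck U 2 g -> 'D_v ('D_w g) x = 'D_w ('D_v g) x.
Proof.
move=> oU Ux kg.
apply/eqP; rewrite -subr_eq0 -normr_eq0; apply/eqP/le_anti/andP; split => //.
apply/ler_addgt0Pl => e e0; rewrite addr0.
have e20 : 0 < e / 2 by rewrite divr_gt0.
pose F := 'D_v ('D_w g); pose G := 'D_w ('D_v g).
have cF : {for x, continuous F} by have [_ /(_ w) [_ /(_ v)]] := kg; apply.
have cG : {for x, continuous G} by have [_ /(_ v) [_ /(_ w)]] := kg; apply.
pose N := [set y | U y /\ (`|F x - F y| < e / 2 /\ `|G x - G y| < e / 2)].
have nN : nbhs x N.
  apply: filterI; first exact: open_nbhs_nbhs.
  by apply: filterI; [move/cvgr_dist_lt: cF|move/cvgr_dist_lt: cG]; exact.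
have /nbhs_normP [r /= r0 rN] := nN.
pose c := 1 + `|v| + `|w|.
have c0 : 0 < c by rewrite /c -addrA ltr_pwDl// addr_ge0.
pose s := r / c.
have s0 : 0 < s by rewrite divr_gt0.
have inN a b : 0 <= a <= s -> 0 <= b <= s -> N (x + a *: v + b *: w).
  move=> /andP[a0 as_] /andP[b0 bs]; apply: rN => /=.
  rewrite -addrA opprD addNKr normrN.
  apply: (@le_lt_trans _ _ (s * (`|v| + `|w|))).
    rewrite mulrDr (le_trans (ler_normD _ _))// lerD// normrZ ger0_norm//.
      by rewrite ler_wpM2r.
    by rewrite ler_wpM2r.
  rewrite -[ltRHS](divfK (lt0r_neq0 c0)) -/s ltr_pM2l//.
  by rewrite /c -addrA ltrDr.
have inU a b : 0 <= a <= s -> 0 <= b <= s -> U (x + a *: v + b *: w).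
  by move=> as_ bs; have [] := inN a b as_ bs.
have inU' a b : 0 <= a <= s -> 0 <= b <= s -> U (x + a *: w + b *: v).
  by move=> as_ bs; rewrite addrAC; exact: inU.
have [a [b [as_ bs E1]]] : exists a b, [/\ 0 <= a <= s, 0 <= b <= s &
    g (x + s *: v + s *: w) - g (x + s *: v) - (g (x + s *: w) - g x) =
    s * (s * G (x + a *: v + b *: w))] := second_difference s0 kg inU.
have [a' [b' [as' bs' E2]]] : exists a b, [/\ 0 <= a <= s, 0 <= b <= s &
    g (x + s *: w + s *: v) - g (x + s *: w) - (g (x + s *: v) - g x) =
    s * (s * F (x + a *: w + b *: v))] := second_difference s0 kg inU'.
have [Fd Gd] : `|F x - F (x + a' *: w + b' *: v)| < e / 2 /\
    `|G x - G (x + a *: v + b *: w)| < e / 2.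
  have [_ [_ Gd]] := inN a b as_ bs.
  have [_ [Fd _]] := inN b' a' bs' as'.
  split; last exact: Gd.
  rewrite (addrAC x (a' *: w)); exact: Fd.
change (`|F x - G x| <= e).
move: Fd Gd E1 E2; move: (F x) (G x) (F (_ + _)) (G (_ + _)).
move=> Fx Gx Fq Gp Fd Gd E1 E2.
have FG : Fq = Gp.
  have : s * (s * Fq) = s * (s * Gp).
    by rewrite -E1 -E2 (addrAC x (s *: w)); ring.
  by move=> /(mulfI (lt0r_neq0 s0)) /(mulfI (lt0r_neq0 s0)).
rewrite (splitr e) -(subrKA Fq) (le_trans (ler_normD _ _))//.
by rewrite lerD//; [exact: ltW|rewrite FG distrC; exact: ltW].
Qed.

End schwarz.

(** * Coordinates and rotations of R^3 *)

Section coordinates.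
Variable R : realType.
Implicit Types (u v w x : 'rV[R]_3).

Lemma ord3_ind (P : 'I_3 -> Prop) : P 0 -> P 1 -> P 2 -> forall i, P i.
Proof.
move=> P0 P1 P2 [[|[|[|//]]] h].
- by rewrite (_ : Ordinal h = 0)//; apply/val_inj.
- by rewrite (_ : Ordinal h = 1)//; apply/val_inj.
- by rewrite (_ : Ordinal h = 2)//; apply/val_inj.
Qed.

Lemma sum3 (V : nmodType) (F : 'I_3 -> V) : \sum_i F i = F 0 + F 1 + F 2.
Proof.
rewrite !big_ord_recl big_ord0 addr0 addrA.
by congr (F _ + F _ + F _); apply/val_inj.
Qed.

Lemma row3P u v : u 0 0 = v 0 0 -> u 0 1 = v 0 1 -> u 0 2 = v 0 2 -> u = v.
Proof. by move=> h0 h1 h2; apply/rowP; elim/ord3_ind. Qed.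

Lemma vec3E (a b c : R) : ((vec3 a b c 0 0 = a) * (vec3 a b c 0 1 = b) *
  (vec3 a b c 0 2 = c))%type.
Proof. by rewrite /vec3 !mxE. Qed.

Lemma dot3 u v : dot u v = u 0 0 * v 0 0 + u 0 1 * v 0 1 + u 0 2 * v 0 2.
Proof. exact: sum3. Qed.

Lemma crossE u v :
  ((cross u v 0 0 = u 0 1 * v 0 2 - u 0 2 * v 0 1) *
  (cross u v 0 1 = u 0 2 * v 0 0 - u 0 0 * v 0 2) *
  (cross u v 0 2 = u 0 0 * v 0 1 - u 0 1 * v 0 0))%type.
Proof.
by rewrite /cross !mxE; split; first split; congr (u _ _ * v _ _ - u _ _ * v _ _);
  apply/val_inj.
Qed.

Lemma curlE (F : 'rV[R]_3 -> 'rV[R]_3) x :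
  ((curl F x 0 0 = pd 1 (fun y => F y 0 2) x - pd 2 (fun y => F y 0 1) x) *
  (curl F x 0 1 = pd 2 (fun y => F y 0 0) x - pd 0 (fun y => F y 0 2) x) *
  (curl F x 0 2 = pd 0 (fun y => F y 0 1) x - pd 1 (fun y => F y 0 0) x))%type.
Proof.
have e i j k l : i = j -> k = l ->
  pd i (fun y => F y 0 k) x = pd j (fun y => F y 0 l) x by move=> -> ->.
by rewrite /curl !mxE; split; first split; congr (_ - _); apply: e; apply/val_inj.
Qed.

Lemma divE (F : 'rV[R]_3 -> 'rV[R]_3) x : div F x =
  pd 0 (fun y => F y 0 0) x + pd 1 (fun y => F y 0 1) x
  + pd 2 (fun y => F y 0 2) x.
Proof. exact: sum3. Qed.

Lemma dot_sym n (u v : 'rV[R]_n) : dot u v = dot v u.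
Proof. by apply: eq_bigr => i _; rewrite mulrC. Qed.

Lemma dotDl n (u v w : 'rV[R]_n) : dot (u + v) w = dot u w + dot v w.
Proof. by rewrite /dot -big_split; apply: eq_bigr => i _; rewrite mxE mulrDl. Qed.

Lemma dotZl n a (u v : 'rV[R]_n) : dot (a *: u) v = a * dot u v.
Proof. by rewrite /dot mulr_sumr; apply: eq_bigr => i _; rewrite mxE mulrA. Qed.

Lemma dotZr n a (u v : 'rV[R]_n) : dot u (a *: v) = a * dot u v.
Proof. by rewrite dot_sym dotZl dot_sym. Qed.

Lemma dot_ge0 n (u : 'rV[R]_n) : 0 <= dot u u.
Proof. by apply: sumr_ge0 => i _; rewrite -expr2 sqr_ge0. Qed.

Lemma dot_eq0 n (u : 'rV[R]_n) : (dot u u == 0) = (u == 0).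
Proof.
apply/idP/eqP => [/eqP h|->]; last first.
  by rewrite /dot big1// => i _; rewrite mxE mul0r.
apply/rowP => i; rewrite mxE.
have /psumr_eq0P /(_ i) := h.
by move=> /(_ (fun i _ => sqr_ge0 (u 0 i)) isT) /eqP; rewrite mulf_eq0 orbb => /eqP.
Qed.

Definition rot (t : R) x : 'rV[R]_3 :=
  vec3 (cos t * x 0 0 - sin t * x 0 1) (sin t * x 0 0 + cos t * x 0 1) (x 0 2).

Lemma rotE t x : ((rot t x 0 0 = (cos t * x 0 0 - sin t * x 0 1)%R) *
  (rot t x 0 1 = (sin t * x 0 0 + cos t * x 0 1)%R) * (rot t x 0 2 = x 0 2))%type.
Proof. by rewrite /rot !vec3E. Qed.

Lemma rotD s t x : rot (s + t) x = rot s (rot t x).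
Proof. by apply: row3P; rewrite !rotE ?cosD ?sinD; ring. Qed.

Lemma rot0 x : rot 0 x = x.
Proof. by apply: row3P; rewrite !rotE ?cos0 ?sin0; ring. Qed.

Lemma rotK t : cancel (rot t) (rot (- t)).
Proof. by move=> x; rewrite -rotD addNr rot0. Qed.

Lemma rotNK t : cancel (rot (- t)) (rot t).
Proof. by move=> x; rewrite -rotD subrr rot0. Qed.

Lemma sin2E (t : R) : sin t ^+ 2 = 1 - cos t ^+ 2.
Proof. by rewrite -(cos2Dsin2 t); ring. Qed.

Lemma dot_rot t x y : dot (rot t x) (rot t y) = dot x y.
Proof.
rewrite !dot3 !rotE; have := sin2E t.
move: (cos t) (sin t) => c s; rewrite !expr2 => h.
transitivity ((c * c + s * s) * (x 0 0 * y 0 0 + x 0 1 * y 0 1) + x 0 2 * y 0 2).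
  by ring.
by rewrite h; ring.
Qed.

Lemma rot_cyl t r a z : rot t (cyl r a z) = cyl r (t + a) z.
Proof. by rewrite /cyl; apply: row3P; rewrite !rotE !vec3E ?cosD ?sinD; ring. Qed.

Lemma rotZD t (a : R) x y : rot t (a *: x + y) = a *: rot t x + rot t y.
Proof.
by apply: row3P; rewrite !(rotE, mxE)/=; ring.
Qed.

Lemma rot_eq0 t x : (rot t x == 0) = (x == 0).
Proof. by rewrite -!dot_eq0 dot_rot. Qed.

Lemma smooth_vec3 (V : normedModType R) (A : set V) (a b c : V -> R) :
  smooth A a -> smooth A b -> smooth A c ->
  smooth A (fun p => vec3 (a p) (b p) (c p)).
Proof.
move=> sa sb sc; apply/smooth_rVP; elim/ord3_ind;
by [apply: smooth_ext sa => p _; rewrite vec3E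
  |apply: smooth_ext sb => p _; rewrite vec3E
  |apply: smooth_ext sc => p _; rewrite vec3E].
Qed.

Lemma smooth_rot (A : set 'rV[R]_3) t : smooth A (rot t).
Proof.
have c i a : smooth A (fun x : 'rV[R]_3 => a * x 0 i).
  by apply: smoothM; [exact: smooth_cst|exact: smooth_coord].
apply: smooth_vec3; last exact: smooth_coord.
  by apply: smoothD => //; apply: smoothN.
exact: smoothD.
Qed.

Lemma differentiable_rot t x : differentiable (rot t) x.
Proof.
exact: (smooth_differentiable (A := setT) openT _ _ (smooth_rot _ t)).
Qed.

Lemma continuous_rot t : continuous (rot t).
Proof. by move=> x; apply: differentiable_continuous; exact: differentiable_rot. Qed.

Lemma derive_rot t v x : 'D_v (rot t) x = rot t v.
Proof.
have E i : ('D_v (rot t) x) 0 i = 'D_v (fun y => rot t y 0 i) x.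
  exact: (derive_rV _ _ (differentiable_rot t x)).
have dc i : derivable (fun y : 'rV[R]_3 => y 0 i) x v.
  by apply: diff_derivable; exact: differentiable_coord.
have dv i := derive_coord v i x.
have cE (a : R) i : 'D_v (fun y : 'rV[R]_3 => a * y 0 i) x = a * v 0 i.
  by rewrite (@deriveZ _ _ _ (fun y : 'rV[R]_3 => y 0 i)) ?dv.
have cd (a : R) i : derivable (fun y : 'rV[R]_3 => a * y 0 i) x v.
  exact: (@derivableZ _ _ _ (fun y : 'rV[R]_3 => y 0 i)).
apply: row3P; rewrite E !rotE; under eq_fun do rewrite rotE.
- by rewrite (@deriveB _ _ _ (fun y : 'rV[R]_3 => cos t * y 0 0)) ?cE.
- by rewrite (@deriveD _ _ _ (fun y : 'rV[R]_3 => sin t * y 0 0)) ?cE.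
- exact: dv.
Qed.

End coordinates.

(** * Boundary and compactness of toroidal domains *)

Section boundary.
Variable R : realType.
Implicit Types (Omega : set 'rV[R]_3).

Lemma compact_coord_bounded n (A : set 'rV[R]_n) (M : R) : closed A ->
  (forall x, A x -> forall i, `|x 0 i| <= M) -> compact A.
Proof.
move=> cA AM.
have cM : compact [set x : 'rV[R]_n | forall i, `[- M, M]%classic (x ord0 i)].
  by apply: (@rV_compact _ _ (fun=> `[- M, M]%classic)) => i; exact: segment_compact.
apply: (subclosed_compact cA cM) => x Ax i /=.
by rewrite in_itv /= -ler_norml; exact: AM.
Qed.

Lemma compact_smooth_image (V W : normedModType R) (A : set V) (f : V -> W) :
  compact A -> smooth A f -> compact (f @` A).
Proof.
move=> cA [U [g [oU AU kg gf]]].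
have -> : f @` A = g @` A.
  apply/seteqP; split=> _ [x Ax <-]; exists x => //; first exact: gf.
  by rewrite gf.
apply: continuous_compact cA.
by apply: continuous_in_subspaceT => x /set_mem /AU; exact: (kg 0).
Qed.

Lemma grad_coord (x u : 'rV[R]_3) i : dot (delta_mx 0 i) u = u 0 i.
Proof.
rewrite /dot (bigD1 i)//= big1 => [|j ji]; first by rewrite addr0 mxE !eqxx mul1r.
by rewrite mxE (negbTE ji) andbF mul0r.
Qed.

Lemma bdryE Omega p : open Omega -> bdry Omega p <-> closure Omega p /\ ~ Omega p.
Proof.
move=> oO; rewrite /bdry; split=> -[cp np]; split=> //.
  by move=> Op; apply: np; rewrite /interior; exact: open_nbhs_nbhs.
by move=> /interior_subset.
Qed.

(** A point of the closure with g > 0 would have points of Omega close to it in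
    the open set where g > 0. *)
Lemma defining_function_sign Omega p g : open Omega -> defining_function Omega p g ->
  bdry Omega p -> exists U, [/\ open U, U p, forall n, Ck U n g &
   forall x, U x -> closure Omega x -> g x <= 0 /\ (~ Omega x -> g x = 0)].
Proof.
move=> oO [_ [U [oU Up kg gU]]] bp; exists U; split=> // x Ux cx.
have gx0 : g x <= 0.
  rewrite leNgt; apply/negP => gx.
  have oI : open (U `&` g @^-1` [set y : R | 0 < y]).
    by apply: open_setI_preim (kg 0) => //; exact: open_gt.
  have [y [Oy [Uy gy]]] := cx _ (open_nbhs_nbhs (conj oI (conj Ux gx))).
  by move: gy => /=; rewrite ltNge ltW//; apply/gU.
split=> // nO; apply/eqP; rewrite eq_le gx0 leNgt /=; apply/negP => gx.
by apply: nO; apply/gU.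
Qed.

(** Omega lies on one side of its boundary: from a boundary point, the gradient
    of a defining function leads to points with g > 0, which are outside the
    closure. Rotations, which are known to preserve the closure, therefore
    preserve Omega. *)
Lemma interior_closure Omega : open Omega -> analytic_boundary Omega ->
  interior (closure Omega) = Omega.
Proof.
move=> oO aO; apply/seteqP; split; last first.
  by move=> x Ox; apply: filterS (@subset_closure _ Omega) _; exact: open_nbhs_nbhs.
move=> p ip; apply: contrapT => nOp.
have cp := interior_subset ip.
have bp : bdry Omega p by apply/bdryE.
have [g [dg _]] := aO p bp.
have [U [oU Up kg gU]] := defining_function_sign oO dg bp.
have gp0 : g p = 0 by have [_] := gU p Up cp; apply.
have [gr _] := dg.
have dgp : differentiable g p by have [d _] := kg 1; exact: d.
pose v := grad g p.
have Dv : 0 < 'D_v g p.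
  by rewrite derive_dot_grad// lt_def dot_ge0 andbT dot_eq0.
have Dc : h^-1 *: (g (h *: v + p) - g p) @[h --> 0^'] --> 'D_v g p.
  exact: diff_derivable.
have /cvg_dnbhs_at_right /cvgr_gt /(_ _ Dv) gt0 := Dc.
have cl : {for 0, continuous (fun h : R => h *: v + p)}.
  apply: differentiable_continuous.
  apply: (@differentiableD _ _ _ (fun h : R => h *: v) (cst p)) => //.
have nin : \forall h \near (0 : R), U (h *: v + p) /\ closure Omega (h *: v + p).
  apply: (cl (U `&` closure Omega)); rewrite scale0r add0r.
  by apply: filterI => //; exact: open_nbhs_nbhs.
near (0 : R)^'+ => h.
have h0 : 0 < h by near: h; exact: nbhs_right_gt.
have [Uh ch] : U (h *: v + p) /\ closure Omega (h *: v + p).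
  by near: h; apply: cvg_within; exact: nin.
have : 0 < h^-1 *: (g (h *: v + p) - g p) by near: h.
rewrite gp0 subr0 /GRing.scale /= pmulr_rgt0 ?invr_gt0// ltNge.
by have [-> _] := gU _ Uh ch.
Unshelve. all: by end_near. Qed.

Lemma tangent_to_boundaryP Omega (F : 'rV[R]_3 -> 'rV[R]_3) :
  tangent_to_boundary Omega F <-> forall p g, bdry Omega p ->
    defining_function Omega p g -> dot (F p) (grad g p) = 0.
Proof.
split=> [tF p g bp dg|tF p nu [bp [g [dg ->]]]]; last first.
  by rewrite dotZr tF// mulr0.
have : dot (F p) ((Num.sqrt (dot (grad g p) (grad g p)))^-1 *: grad g p) = 0.
  by apply: tF; split=> //; exists g.
rewrite dotZr => /eqP; rewrite mulf_eq0 invr_eq0 sqrtr_eq0 leNgt lt_def dot_ge0.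
by have [g0 _] := dg; rewrite dot_eq0 g0 => /eqP.
Qed.

Lemma defining_function_rot Omega t p g :
  (forall x, Omega x -> Omega (rot (- t) x)) ->
  (forall x, Omega x -> Omega (rot t x)) ->
  defining_function Omega (rot t p) g ->
  defining_function Omega p (fun x => g (rot t x)) /\
  grad g (rot t p) = rot t (grad (fun x => g (rot t x)) p).
Proof.
move=> rO1 rO2 [g0 [U [oU Up kg gU]]].
have oU' : open (rot t @^-1` U).
  by apply: open_comp => // x _; exact: continuous_rot.
have dg : differentiable g (rot t p) by have [d _] := kg 1; exact: d.
have gE : grad g (rot t p) = rot t (grad (fun x => g (rot t x)) p).
  apply: (can_inj (rotNK t)); rewrite rotK.
  apply/rowP => i; rewrite [RHS]mxE /pd.
  rewrite (@derive_comp _ _ _ _ (rot t) g)//; last exact: differentiable_rot.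
  rewrite derive_rot derive_dot_grad// -[in RHS](rotNK t (grad g _)) dot_rot.
  by rewrite grad_coord.
split=> //; split; first by apply: contra g0; rewrite gE rot_eq0.
exists (rot t @^-1` U); split=> //.
  move=> n; apply: (Ck_comp (U' := U)) => //.
  exact: (smooth_Ck n oU' (@subsetT _ _) (smooth_rot _ t)).
move=> x Ux; rewrite -gU//; split; first exact: rO2.
by move=> /rO1; rewrite rotK.
Qed.

End boundary.

Section domain.
Variable R : realType.
Variable Omega : set 'rV[R]_3.
Hypothesis hOmega : toroidal_domain Omega.

Let oO : open Omega. Proof. by have [] := hOmega. Qed.

Lemma smooth_dot_self n (A : set 'rV[R]_n) : smooth A (fun x => dot x x).
Proof. by apply: smooth_sum => i; apply: smoothM; exact: smooth_coord. Qed.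

Lemma smooth_continuous (V W : normedModType R) (A U : set V) (f : V -> W) x :
  open U -> U `<=` A -> U x -> smooth A f -> {for x, continuous f}.
Proof. by move=> oU UA Ux /(smooth_Ck 0 oU UA); apply. Qed.

Lemma unit_disk_compact : compact (@unit_disk R).
Proof.
apply: (@compact_coord_bounded _ _ _ 1) => [|s s1 i].
  have -> : unit_disk (R := R) = (fun s : 'rV[R]_2 => dot s s) @^-1` [set y | y <= 1].
    by [].
  apply: closed_comp => [s _|]; last exact: closed_le.
  exact: (smooth_continuous openT (@subsetT _ _) _ (smooth_dot_self _)).
rewrite -(expr_le1 (n := 2))// real_normK ?num_real//; apply: le_trans s1.
rewrite /dot (bigD1 i)//= -expr2 lerDl sumr_ge0// => j _.
by rewrite -expr2 sqr_ge0.
Qed.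

Lemma section_compact : compact (section Omega).
Proof.
have [_ _ _ [f [_ [g [sg fP gP]]]] _] := hOmega.
have -> : section Omega = g @` (@unit_disk R).
  apply/seteqP; split=> [s Ss|_ [y uy <-]]; last by have [] := gP y uy.
  by have [us gs] := fP s Ss; exists (f s).
exact: compact_smooth_image unit_disk_compact sg.
Qed.

Lemma closureE x : closure Omega x <-> exists s t, section Omega s /\
  x = cyl (s 0 0) t (s 0 1).
Proof. by have [_ _ _ _ h] := hOmega; rewrite {1}h. Qed.

Lemma closure_rot t x : closure Omega x -> closure Omega (rot t x).
Proof.
move=> /closureE [s [a [Ss ->]]]; apply/closureE; exists s, (t + a).
by rewrite rot_cyl.
Qed.

Lemma interior_closure_Omega : interior (closure Omega) = Omega.
Proof. by have [_ _ aO _ _] := hOmega; exact: interior_closure. Qed.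

Lemma Omega_rot t x : Omega x -> Omega (rot t x).
Proof.
rewrite -{1}interior_closure_Omega -{2}interior_closure_Omega => ix.
have : nbhs (rot t x) (rot (- t) @^-1` (closure Omega)).
  by apply: continuous_rot; rewrite rotK.
by apply: filterS => y /= /(@closure_rot t _); rewrite rotNK.
Qed.

Lemma rsq_gt0 x : closure Omega x -> 0 < rsq x.
Proof.
move=> /closureE [s [a [[s0 _] ->]]]; rewrite /rsq /cyl !vec3E !exprMn -mulrDr.
by rewrite cos2Dsin2 mulr1 exprn_gt0.
Qed.

Lemma closure_bounded : exists M : R, forall x, closure Omega x ->
  forall i, `|x 0 i| <= M.
Proof.
have bc j : exists M : R, forall s, section Omega s -> `|s 0 j| <= M.
  have := compact_smooth_image section_compact (smooth_coord (section Omega) j).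
  move=> /compact_bounded [M [_ hM]]; exists (M + 1) => s Ss.
  by apply: (hM (M + 1)); [rewrite ltrDl|exists s].
have [M0 h0] := bc 0; have [M1 h1] := bc 1.
exists (Num.max M0 M1) => _ /closureE [s [a [Ss ->]]].
rewrite /cyl; elim/ord3_ind; rewrite vec3E le_max.
- by rewrite normrM (le_trans _ (h0 s Ss))// ler_piMr// ler_norml cos_geN1 cos_le1.
- by rewrite normrM (le_trans _ (h0 s Ss))// ler_piMr// ler_norml sin_geN1 sin_le1.
- by rewrite h1// orbT.
Qed.

Lemma closure_compact : compact (closure Omega).
Proof.
by have [M hM] := closure_bounded; apply: (compact_coord_bounded _ hM); exact: closed_closure.
Qed.

Lemma section_nonempty : section Omega !=set0.
Proof.
have [_ _ _ [f [_ [g [sg fP gP]]]] _] := hOmega.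
exists (g 0); have [] // := gP 0.
by rewrite /unit_disk /= /dot big1// => i _; rewrite mxE mul0r.
Qed.

Lemma section_embed s : section Omega s -> closure Omega (embed s).
Proof. by case. Qed.

Lemma Omega_nonempty : Omega !=set0.
Proof.
have [s /section_embed cs] := section_nonempty.
by have [y [Oy _]] := cs setT filterT; exists y.
Qed.

(** A rotation takes defining functions to defining functions, hence normals to
    normals. *)
Lemma tangent_rot F t : tangent_to_boundary Omega F ->
  tangent_to_boundary Omega (fun x => rot (- t) (F (rot t x))).
Proof.
move=> /tangent_to_boundaryP tF; apply/tangent_to_boundaryP => p g bp dg.
have [dg' gE] : defining_function Omega (rot t p) (fun x => g (rot (- t) x)) /\
    grad g p = rot (- t) (grad (fun x => g (rot (- t) x)) (rot t p)).
  have := @defining_function_rot R Omega (- t) (rot t p) g.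
  by rewrite rotK opprK; apply=> //; exact: Omega_rot.
rewrite gE dot_rot; apply: tF dg'.
move/bdryE: bp => /(_ oO) [cp nO]; apply/bdryE => //; split; first exact: closure_rot.
by move=> /(@Omega_rot (- t) _); rewrite rotK.
Qed.

End domain.

(** * Orbits and first integrals of braided fields *)

Section angle.
Variable R : realType.

(** In polar coordinates y0 = rho cos theta and y1 = rho sin theta, the quotient
    is cot (theta / 2), so that the function is (pi - theta) / 2 with theta in
    ]0, 2 pi[. Halving the angle gives one formula that is smooth off the
    half-line theta = 0. *)
Lemma angle_derive (y0 y1 : R -> R) (t b0 b1 : R) :
  is_derive t 1 y0 b0 -> is_derive t 1 y1 b1 ->
  0 < y0 t ^+ 2 + y1 t ^+ 2 ->
  0 < Num.sqrt (y0 t ^+ 2 + y1 t ^+ 2) - y0 t ->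
  is_derive t 1
    (fun s => atan (y1 s / (Num.sqrt (y0 s ^+ 2 + y1 s ^+ 2) - y0 s)))
    (- (y0 t * b1 - y1 t * b0) / (2 * (y0 t ^+ 2 + y1 t ^+ 2))).
Proof.
move=> d0 d1 q0 p0.
set rho := Num.sqrt _ in p0.
have rho0 : 0 < rho by rewrite sqrtr_gt0.
have rho2 : rho ^+ 2 = y0 t ^+ 2 + y1 t ^+ 2 by rewrite sqr_sqrtr// ltW.
pose q : R -> R := (y0 ^+ 2 + y1 ^+ 2).
have dq : is_derive t 1 q (2 * (y0 t * b0 + y1 t * b1)).
  apply: is_derive_eq; rewrite /GRing.scale /= !expr1 !mulr2n; ring.
have qt : q t = y0 t ^+ 2 + y1 t ^+ 2 by [].
have dsq : is_derive (q t) 1 Num.sqrt (2 * Num.sqrt (q t))^-1.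
  by apply: is_derive1_sqrt; rewrite qt.
have drho : is_derive t 1 (Num.sqrt \o q) ((y0 t * b0 + y1 t * b1) / rho).
  apply: is_derive_eq; rewrite qt -/rho.
  by field; rewrite gt_eqF.
pose p : R -> R := (Num.sqrt \o q) - y0.
have dp : is_derive t 1 p ((y0 t * b0 + y1 t * b1) / rho - b0) by apply: is_derive_eq.
have pt : p t = rho - y0 t by [].
have pn0 : p t != 0 by rewrite pt gt_eqF.
have dV : is_derive t 1 (fun s => (p s)^-1)
  (- (p t) ^- 2 *: ((y0 t * b0 + y1 t * b1) / rho - b0)).
  exact: is_deriveV.
pose u : R -> R := y1 * (fun s => (p s)^-1).
have du : is_derive t 1 u ((y0 t * b1 - y1 t * b0) * - (rho * (rho - y0 t))^-1).
  apply: is_derive_eq; rewrite /GRing.scale /= pt.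
  clear -rho2 rho0 p0.
  move: (y0 t) (y1 t) rho rho0 p0 rho2 => a b r r0 p0 r2.
  have rn0 : r != 0 by rewrite gt_eqF.
  have pn0 : r - a != 0 by rewrite gt_eqF.
  transitivity ((a * b1 - b * b0) * - (r * (r - a))^-1 +
                b1 * (r ^+ 2 - (a ^+ 2 + b ^+ 2)) / (r * (r - a) ^+ 2)).
    by field; rewrite rn0 pn0.
  by rewrite r2 subrr mulr0 mul0r addr0.
have da := is_derive1_atan (u t).
have : is_derive t 1 (atan \o u) (- (y0 t * b1 - y1 t * b0) / (2 * (y0 t ^+ 2 + y1 t ^+ 2))).
  apply: is_derive_eq; rewrite -rho2.
  have -> : u t = y1 t / (rho - y0 t) by [].
  clear -rho2 rho0 p0.
  move: (y0 t) (y1 t) rho rho0 p0 rho2 => a b r r0 p0 r2.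
  have rn0 : r != 0 by rewrite gt_eqF.
  have pn0 : r - a != 0 by rewrite gt_eqF.
  have -> : 1 + (b / (r - a)) ^+ 2 = 2 * r / (r - a).
    transitivity (2 * r / (r - a) + (a ^+ 2 + b ^+ 2 - r ^+ 2) / (r - a) ^+ 2).
      by field; rewrite pn0.
    by rewrite r2 subrr mul0r addr0.
  by field; rewrite rn0 pn0.
by [].
Qed.

End angle.

Section orbits.
Variable R : realType.
Variable Omega : set 'rV[R]_3.
Hypothesis hOmega : toroidal_domain Omega.

Lemma smooth_bounded (f : 'rV[R]_3 -> R) : smooth (closure Omega) f ->
  exists M : R, forall x, closure Omega x -> `|f x| <= M.
Proof.
move=> sf; have := compact_smooth_image (closure_compact hOmega) sf.
move=> /compact_bounded [M [_ hM]]; exists (M + 1) => x cx.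
by apply: (hM (M + 1)); [rewrite ltrDl|exists x].
Qed.

Lemma smooth_rsq (A : set 'rV[R]_3) : smooth A (@rsq R).
Proof.
by apply: smoothD; apply: smoothM; exact: smooth_coord.
Qed.

Lemma smooth_d_theta (A : set 'rV[R]_3) : smooth A (@d_theta R).
Proof.
apply: smooth_vec3; [apply: smoothN| |exact: smooth_cst]; exact: smooth_coord.
Qed.

Lemma theta_component_bounded_below B : braided Omega B ->
  exists2 e : R, 0 < e & forall x, closure Omega x -> e <= theta_component B x.
Proof.
move=> [sB _ _ B0].
have s1 : smooth (closure Omega) (theta_component B).
  apply: smoothM; first by apply: smooth_dot => //; exact: smooth_d_theta.
  by apply: smoothV (smooth_rsq _) => x /(rsq_gt0 hOmega) /gt_eqF ->.
have s2 : smooth (closure Omega) (fun x => (theta_component B x)^-1).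
  by apply: smoothV s1 => x /B0 /gt_eqF ->.
have [M hM] := smooth_bounded s2.
exists (`|M| + 1)^-1; first by rewrite invr_gt0 ltr_wpDl.
move=> x cx; have t0 := B0 x cx; rewrite -[leRHS]invrK lef_pV2 ?posrE ?invr_gt0 ?ltr_wpDl//.
rewrite (le_trans (ler_norm _))// (le_trans (hM x cx))//.
by rewrite (le_trans (ler_norm _))// lerDl.
Qed.

Lemma is_derive_coord n (c : R -> 'rV[R]_n) (dc : 'rV[R]_n) (t : R) i :
  is_derive t 1 c dc -> is_derive t 1 (fun s => c s 0 i) (dc 0 i).
Proof.
move=> [d <-]; have d' := (proj1 (derivable_mxP c t 1) d).
by apply: DeriveDef; [exact: d'|rewrite derive_mx// mxE].
Qed.

(** On an orbit that avoids the section the angle is a smooth function with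
    values in ]0, 2 pi[, yet it grows at a rate at least e, which is impossible
    over a time 2 pi / e. *)
Lemma orbit_meets_section B phi x : braided Omega B -> is_flow Omega B phi ->
  closure Omega x -> exists t s, section Omega s /\ phi t x = embed s.
Proof.
move=> bB fphi cx; apply: contrapT => nE.
have [e e0 eB] := theta_component_bounded_below bB.
have [_ fx] := fphi x cx.
pose y i (t : R) : R := phi t x 0 i.
have cphi t : closure Omega (phi t x) by have [] := fx t.
have q0 t : 0 < y 0 t ^+ 2 + y 1 t ^+ 2 by exact: rsq_gt0 (cphi t).
have nh t : y 1 t = 0 -> y 0 t <= 0.
  move=> y1; rewrite leNgt; apply/negP => y0; apply: nE.
  exists t, (vec2 (y 0 t) (y 2 t)).
  have E : phi t x = embed (vec2 (y 0 t) (y 2 t)).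
    by apply: row3P; rewrite /embed vec3E /vec2 ?mxE.
  by split=> //; split; [rewrite /vec2 mxE|rewrite -E].
have p0 t : 0 < Num.sqrt (y 0 t ^+ 2 + y 1 t ^+ 2) - y 0 t.
  rewrite subr_gt0; have [/nh y0|y1] := eqVneq (y 1 t) 0.
    by rewrite (le_lt_trans y0)// sqrtr_gt0.
  rewrite (le_lt_trans (ler_norm _))// -sqrtr_sqr ltr_sqrt//.
  by rewrite ltrDl exprn_even_gt0.
pose F s := atan (y 1 s / (Num.sqrt (y 0 s ^+ 2 + y 1 s ^+ 2) - y 0 s)).
have dF (t : R) : is_derive t 1 F (- theta_component B (phi t x) / 2).
  have [_ dphi] := fx t.
  have := angle_derive (is_derive_coord 0 dphi) (is_derive_coord 1 dphi) (q0 t) (p0 t).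
  move=> dA; apply: is_derive_eq dA _.
  rewrite /theta_component dot3 /d_theta !vec3E -/(y 0 t) -/(y 1 t) /rsq.
  rewrite -/(y 0 t) -/(y 1 t).
  by field; rewrite gt_eqF.
(* F takes values in an interval of length pi and decreases at a rate at least
   e / 2. *)
have pe : 0 < 2 * pi / e by rewrite divr_gt0// mulr_gt0// pi_gt0.
have [|c _ ] := @MVT R F (fun t => - theta_component B (phi t x) / 2) 0 _ pe
  (fun t _ => dF t).
  apply: derivable_within_continuous => t _.
  by have [] := dF t.
rewrite subr0 => FE.
have : F (2 * pi / e) - F 0 <= - pi.
  rewrite FE; have := eB _ (cphi c); set th := theta_component _ _ => eth.
  have -> : - th / 2 * (2 * pi / e) = - (th / e * pi) by field; rewrite gt_eqF.
  by rewrite lerN2 ler_peMl ?pi_ge0// ler_pdivlMr// mul1r.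
apply/negP; rewrite -ltNge.
have := atan_gtNpi2 (y 1 (2 * pi / e) / (Num.sqrt (y 0 (2 * pi / e) ^+ 2 + y 1 (2 * pi / e) ^+ 2) - y 0 (2 * pi / e))).
have := atan_ltpi2 (y 1 0 / (Num.sqrt (y 0 0 ^+ 2 + y 1 0 ^+ 2) - y 0 0)).
rewrite -/(F _) -/(F _); lra.
Qed.

End orbits.

Section first_integrals.
Variable R : realType.
Variable Omega : set 'rV[R]_3.
Hypothesis hOmega : toroidal_domain Omega.

Let oO : open Omega. Proof. by have [] := hOmega. Qed.
Let OcO : Omega `<=` closure Omega. Proof. exact: subset_closure. Qed.

(** The derivative of an extension of class C^1 along a continuous field is
    continuous up to the boundary. *)
Lemma derive_along_closure (U : set 'rV[R]_3) (g : 'rV[R]_3 -> R)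
    (B : 'rV[R]_3 -> 'rV[R]_3) : open U -> closure Omega `<=` U ->
  (forall n, Ck U n g) -> smooth (closure Omega) B ->
  (forall x, Omega x -> dot (B x) (grad g x) = 0) ->
  forall x, closure Omega x -> 'D_(B x) g x = 0.
Proof.
move=> oU cU kg [U' [B' [oU' cU' kB BB]]] gB x cx.
have dg y : U y -> differentiable g y by have [d _] := kg 1; exact: d.
rewrite derive_dot_grad; last by apply: dg; exact: cU.
pose F y := dot (B' y) (grad g y).
rewrite -[LHS]/(dot (B x) (grad g x)) -BB//.
have cF : {for x, continuous F}.
  have kF : Ck (U `&` U') 0 F.
    apply: Ck_sum; first exact: openI.
    move=> i; apply: CkM; first exact: openI.
      apply: (@Ck_sub _ _ _ U') => [y []//|].
      exact: (proj1 (Ck_rVP 0 _ oU') (kB 0) i).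
    apply: (@Ck_sub _ _ _ U) => [y []//|].
    apply: (@Ck_ext _ _ _ _ _ (pd i g)) => //; first by move=> y _; rewrite mxE.
    by have [_] := kg 1; apply.
  by apply: kF; split; [exact: cU|exact: cU'].
apply: (@eq_on_closure _ _ Omega F (fun=> 0) x) => //.
  exact: cst_continuous.
by move=> y Oy; rewrite /F BB ?gB//; exact: OcO.
Qed.

Lemma smooth_embed (A : set 'rV[R]_2) : smooth A (@embed R).
Proof. by apply: smooth_vec3; [exact: smooth_coord|exact: smooth_cst|exact: smooth_coord]. Qed.

(** A first integral is constant on orbits, so its restriction to the section is
    invariant under the Poincare map; conjugation by Y_B makes it invariant
    under J(B), hence constant. Every orbit meets the section. *)
Lemma braided_first_integral_constant J B Q :
  mu_preserving_poincare Omega J -> braided Omega B ->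
  U_NI (section Omega) (J B) -> smooth (closure Omega) Q ->
  (forall x, Omega x -> dot (B x) (grad Q x) = 0) ->
  forall x y, closure Omega x -> closure Omega y -> Q x = Q y.
Proof.
move=> [_ _ hJ] bB [_ _ NI] sQ QB.
have [YB [Pi [[sYB [Z [sZ YZ ZY]]] [phi [fphi hPi]] JYB]]] := hJ B bB.
have [U [Q' [oU cU kQ QQ]]] := sQ.
have Q'B x : closure Omega x -> 'D_(B x) Q' x = 0.
  apply: (derive_along_closure oU cU kQ); first by case: bB.
  move=> y Oy; rewrite -(QB y Oy); congr dot; apply/rowP => i; rewrite !mxE.
  apply: near_eq_derive; apply: (open_near_eq oO) => // z Oz.
  by rewrite QQ//; exact: OcO.
have dQ x : closure Omega x -> differentiable Q' x.
  by move=> /cU Ux; have [d _] := kQ 1; exact: d.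
have Qphi x t : closure Omega x -> Q (phi t x) = Q x.
  move=> cx; have [p0 pt] := fphi x cx.
  have cp s : closure Omega (phi s x) by have [] := pt s.
  rewrite -[in RHS]p0 -!QQ//.
  apply: (@is_derive_0_is_cst _ (fun s => Q' (phi s x))) => s.
  have [_ dp] := pt s.
  by have := is_derive_path dp (dQ _ (cp s)); rewrite Q'B.
pose h s := Q (embed (Z s)).
have sh : smooth (section Omega) h.
  apply: (@smooth_comp _ _ _ _ (closure Omega)) => [s Ss||//].
    by apply: section_embed; have [] := ZY s Ss.
  apply: (@smooth_comp_rV _ _ _ _ _ (section Omega)) sZ (smooth_embed _).
  by move=> s Ss; have [] := ZY s Ss.
have hinv s : section Omega s -> h (J B s) = h s.
  move=> Ss; have [SZ YZs] := ZY s Ss; rewrite -{1}YZs JYB// /h.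
  have [SP [tau [_ tE _]]] := hPi _ SZ.
  have [_ ->] := YZ _ SP.
  by rewrite -tE Qphi//; exact: section_embed.
have hcst s s' : section Omega s -> section Omega s' -> h s = h s'.
  move=> Ss Ss'; apply/eqP; apply: contrapT => /negP ne; apply: NI.
  by exists h; split=> //; exists s, s'.
have Qcst s s' : section Omega s -> section Omega s' ->
    Q (embed s) = Q (embed s').
  move=> Ss Ss'; have [SY <-] := YZ s Ss; have [SY' <-] := YZ s' Ss'.
  exact: hcst.
move=> x y cx cy.
have [t [s [Ss ts]]] := orbit_meets_section hOmega bB fphi cx.
have [t' [s' [Ss' ts']]] := orbit_meets_section hOmega bB fphi cy.
by rewrite -(Qphi x t)// -(Qphi y t')// ts ts'; exact: Qcst.
Qed.

Section pushforward.
Variables (B Y Bbar : 'rV[R]_3 -> 'rV[R]_3).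
Hypothesis bB : braided Omega B.
Hypothesis hY : diffeo (closure Omega) (closure Omega) Y.
Hypothesis hBbar : field_pushforward Omega Y B Bbar.

Lemma pushforward_first_integral_constant J P :
  mu_preserving_poincare Omega J ->
  U_NI (section Omega) (J B) -> smooth (closure Omega) P ->
  (forall x, Omega x -> dot (Bbar x) (grad P x) = 0) ->
  forall x y, closure Omega x -> closure Omega y -> P x = P y.
Proof.
move=> hJ NI sP PB.
have [sY [Z [sZ YZ ZY]]] := hY.
have [sBb BbE] := hBbar.
have [U [P' [oU cU kP PP]]] := sP.
have P'B x : closure Omega x -> 'D_(Bbar x) P' x = 0.
  apply: (derive_along_closure oU cU kP sBb).
  move=> y Oy; rewrite -(PB y Oy); congr dot; apply/rowP => i; rewrite !mxE.
  apply: near_eq_derive; apply: (open_near_eq oO) => // z Oz.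
  by rewrite PP//; exact: OcO.
have sQ : smooth (closure Omega) (fun x => P (Y x)).
  by apply: (smooth_comp _ sY sP) => x /YZ [].
have QB x : Omega x -> dot (B x) (grad (fun x => P (Y x)) x) = 0.
  move=> Ox; have cYx : closure Omega (Y x) by have [] := YZ x (OcO Ox).
  have dY : differentiable Y x := smooth_differentiable oO OcO Ox sY.
  have dP' : differentiable P' (Y x).
    by have [d _] := kP 1; apply: d; exact: cU.
  rewrite -derive_dot_grad; last exact: smooth_differentiable oO OcO Ox sQ.
  transitivity ('D_(B x) (P' \o Y) x).
    apply: near_eq_derive; apply: (open_near_eq oO) => // z Oz /=.
    by have [cYz _] := YZ z (OcO Oz); rewrite (PP _ cYz).
  by rewrite derive_comp// -BbE// P'B.
move=> x y cx cy.
have [cZx <-] := ZY x cx; have [cZy <-] := ZY y cy.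
exact: (braided_first_integral_constant hJ bB NI sQ QB).
Qed.

(** The inverse of Y maps Bbar back to B, on the boundary as well by continuity,
    and B has no zero. *)
Lemma pushforward_neq0 y : closure Omega y -> Bbar y != 0.
Proof.
have [sY [Z [sZ YZ ZY]]] := hY.
have [sBb BbE] := hBbar.
have [sB _ _ B0] := bB.
have [U [Z' [oU cU kZ ZZ]]] := sZ.
have [U1 [Y' [oU1 cU1 kY YY]]] := sY.
have [U2 [B' [oU2 cU2 kB BB]]] := sB.
have [U3 [b' [oU3 cU3 kb bb]]] := sBb.
move=> cy; have [cx xy] := ZY y cy; rewrite -xy; move: (Z y) cx => x cx {xy}.
suff key i : 'D_(Bbar (Y x)) (fun z => Z' z 0 i) (Y x) = B x 0 i.
  apply/eqP => b0; have := B0 x cx; rewrite /theta_component.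
  have -> : B x = 0 by apply/rowP => i; rewrite -key b0 derive0 mxE.
  by rewrite dot3 !mxE !mul0r !addr0 mul0r ltxx.
pose Zi z : R := Z' z 0 i.
have kZi n : Ck U n Zi := proj1 (Ck_rVP n _ oU) (kZ n) i.
have dZ z : U z -> differentiable Zi z by have [d _] := kZi 1; exact: d.
have cY z : closure Omega z -> closure Omega (Y z) by move=> /YZ [].
pose V := U1 `&` Y' @^-1` (U `&` U3).
have oV : open V.
  by apply: open_setI_preim => //; [exact: openI|exact: (kY 0)].
have cV : closure Omega `<=` V.
  move=> z cz; split; first exact: cU1.
  by rewrite /= YY//; split; [apply: cU|apply: cU3]; exact: cY.
pose F z := \sum_j b' (Y' z) 0 j * pd j Zi (Y' z).
have cF : {for x, continuous F}.
  have kF : Ck V 0 F.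
    have kYV : Ck V 0 Y' by apply: Ck_sub (kY 0) => z [].
    apply: Ck_sum => // j; apply: CkM => //.
      apply: (Ck_comp (g := fun z => b' z 0 j) oV _ kYV (proj1 (Ck_rVP 0 _ oU3) (kb 0) j)).
      by move=> z [_ []].
    apply: (Ck_comp (g := pd j Zi) (U' := U) oV _ kYV); first by move=> z [_ []].
    by have [_] := kZi 1; apply.
  by apply: kF; exact: cV.
have cBi : {for x, continuous (fun z => B' z 0 i)}.
  by apply: (proj1 (Ck_rVP 0 _ oU2) (kB 0) i); exact: cU2.
have FE z : closure Omega z -> F z = 'D_(Bbar (Y z)) Zi (Y z).
  move=> cz; rewrite derive_dot_grad; last by apply: dZ; exact/cU/cY.
  by rewrite /F YY// bb; [apply: eq_bigr => j _; rewrite mxE|exact: cY].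
rewrite -/Zi -FE// -BB//.
apply: (@eq_on_closure _ _ Omega F (fun z => B' z 0 i) x) => //.
move=> z Oz; have cz := OcO Oz; rewrite FE// BB//.
have dYz : differentiable Y z := smooth_differentiable oO OcO Oz sY.
rewrite BbE// -(derive_comp _ dYz); last by apply: dZ; exact/cU/cY.
rewrite -(derive_coord (B z) i z); apply: near_eq_derive.
apply: (open_near_eq oO) => // w Ow /=.
by have [cYw ZYw] := YZ w (OcO Ow); rewrite /Zi (ZZ _ cYw) ZYw.
Qed.

End pushforward.
End first_integrals.

(** * Divergence, curl and rotations *)

Section vector_calculus.
Variable R : realType.
Implicit Types (F G : 'rV[R]_3 -> 'rV[R]_3) (f g : 'rV[R]_3 -> R) (x : 'rV[R]_3).

Lemma pdD f g x i : differentiable f x -> differentiable g x ->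
  pd i (fun y => f y + g y) x = pd i f x + pd i g x.
Proof. by move=> df dg; rewrite /pd deriveD//; exact: diff_derivable. Qed.

Lemma pdZ (a : R) f x i : differentiable f x ->
  pd i (fun y => a * f y) x = a * pd i f x.
Proof. by move=> df; rewrite /pd (@deriveZ _ _ _ f)//; exact: diff_derivable. Qed.

Lemma pdM f g x i : differentiable f x -> differentiable g x ->
  pd i (fun y => f y * g y) x = f x * pd i g x + g x * pd i f x.
Proof. by move=> df dg; rewrite /pd deriveM//; exact: diff_derivable. Qed.

Lemma pd_lin (a b : R) f g x i : differentiable f x -> differentiable g x ->
  pd i (fun y => a * f y + b * g y) x = a * pd i f x + b * pd i g x.
Proof.
move=> df dg; rewrite pdD ?pdZ//.
- exact: (@differentiableZ _ _ _ f).
- exact: (@differentiableZ _ _ _ g).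
Qed.

Lemma pd_linear_field (a b : R) F G x i k : differentiable F x -> differentiable G x ->
  pd i (fun y => (a *: F y + b *: G y) 0 k) x =
  a * pd i (fun y => F y 0 k) x + b * pd i (fun y => G y 0 k) x.
Proof.
move=> /differentiable_rVP dF /differentiable_rVP dG.
by rewrite -pd_lin//; congr pd; apply/funext => y; rewrite !mxE.
Qed.

Lemma curl_linear (a b : R) F G x : differentiable F x -> differentiable G x ->
  curl (fun y => a *: F y + b *: G y) x = a *: curl F x + b *: curl G x.
Proof.
move=> dF dG; apply/rowP => i; rewrite [LHS]mxE !pd_linear_field//.
by rewrite mxE [in RHS]mxE [in RHS]mxE mxE mxE; ring.
Qed.

Lemma div_linear (a b : R) F G x : differentiable F x -> differentiable G x ->
  div (fun y => a *: F y + b *: G y) x = a * div F x + b * div G x.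
Proof.
by move=> dF dG; rewrite !divE !pd_linear_field//; ring.
Qed.

Lemma divZ f F x : differentiable f x -> differentiable F x ->
  div (fun y => f y *: F y) x = dot (F x) (grad f x) + f x * div F x.
Proof.
move=> df /differentiable_rVP dF.
have E i : pd i (fun y => (f y *: F y) 0 i) x =
    f x * pd i (fun y => F y 0 i) x + F x 0 i * pd i f x.
  by rewrite -pdM//; congr pd; apply/funext => y; rewrite mxE.
rewrite divE !E dot3 /grad !mxE divE.
move: (pd 0 f x) (pd 1 f x) (pd 2 f x) => f0 f1 f2.
move: (pd 0 _ x) (pd 1 _ x) (pd 2 _ x) => F0 F1 F2.
by ring.
Qed.

Lemma div_curl (U : set 'rV[R]_3) F x : open U -> U x -> Ck U 2 F ->
  div (curl F) x = 0.
Proof.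
move=> oU Ux kF.
have kFi i : Ck U 2 (fun y => F y 0 i) by exact: (proj1 (Ck_rVP 2 F oU) kF i).
have dp i k : differentiable (pd i (fun y => F y 0 k)) x.
  by have [_ /(_ (delta_mx 0 i)) [d _]] := kFi k; exact: d.
have B i (a b : 'I_3) c d' : (fun y => curl F y 0 i) =
    (fun y => pd a (fun z => F z 0 c) y - pd b (fun z => F z 0 d') y) ->
    forall j, pd j (fun y => curl F y 0 i) x =
    pd j (pd a (fun z => F z 0 c)) x - pd j (pd b (fun z => F z 0 d')) x.
  by move=> -> j; rewrite /pd deriveB//; apply: diff_derivable; exact: dp.
have S i j k : pd i (pd j (fun z => F z 0 k)) x = pd j (pd i (fun z => F z 0 k)) x.
  exact: (derive_sym _ _ oU Ux (kFi k)).
rewrite divE (B 0 1 2 2 1); last by apply/funext => y; rewrite curlE.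
rewrite (B 1 2 0 0 2); last by apply/funext => y; rewrite curlE.
rewrite (B 2 0 1 1 0); last by apply/funext => y; rewrite curlE.
rewrite (S 0 1 2) (S 0 2 1) (S 1 2 0).
move: (pd 1 (pd 0 _) x) (pd 2 (pd 0 _) x) (pd 2 (pd 1 _) x) => a b c.
by ring.
Qed.

Lemma dot_cross (u v : 'rV[R]_3) : dot u (cross u v) = 0.
Proof. by rewrite dot3 !crossE; ring. Qed.

(** (u . u) v - (u . v) u = (u x v) x u. *)
Lemma cross_eq0 (u v : 'rV[R]_3) : u != 0 -> cross u v = 0 ->
  v = (dot v u / dot u u) *: u.
Proof.
move=> u0 uv; have uu : dot u u != 0 by rewrite dot_eq0.
have [h0 h1 h2] : [/\ u 0 1 * v 0 2 = u 0 2 * v 0 1,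
    u 0 2 * v 0 0 = u 0 0 * v 0 2 & u 0 0 * v 0 1 = u 0 1 * v 0 0].
  by split; apply/eqP; rewrite -subr_eq0 -crossE uv mxE.
apply: (scalerI uu); rewrite scalerA mulrCA divff// mulr1.
apply: row3P; rewrite !mxE !dot3.
- transitivity (u 0 0 * u 0 0 * v 0 0 + u 0 1 * (u 0 1 * v 0 0) + u 0 2 * (u 0 2 * v 0 0)); first by ring.
  by rewrite h1 -h2; ring.
- transitivity (u 0 0 * (u 0 0 * v 0 1) + u 0 1 * u 0 1 * v 0 1 + u 0 2 * (u 0 2 * v 0 1)); first by ring.
  by rewrite h2 -h0; ring.
- transitivity (u 0 0 * (u 0 0 * v 0 2) + u 0 1 * (u 0 1 * v 0 2) + u 0 2 * u 0 2 * v 0 2); first by ring.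
  by rewrite -h1 h0; ring.
Qed.

Lemma pd_rot f t x : differentiable f (rot t x) ->
  ((pd 0 (fun y => f (rot t y)) x = (cos t * pd 0 f (rot t x) + sin t * pd 1 f (rot t x))%R) *
  (pd 1 (fun y => f (rot t y)) x = (- sin t * pd 0 f (rot t x) + cos t * pd 1 f (rot t x))%R) *
  (pd 2 (fun y => f (rot t y)) x = pd 2 f (rot t x)))%type.
Proof.
move=> df.
have E i : pd i (fun y => f (rot t y)) x = dot (rot t (delta_mx 0 i)) (grad f (rot t x)).
  rewrite /pd (@derive_comp _ _ _ _ (rot t) f)//; last exact: differentiable_rot.
  by rewrite derive_rot derive_dot_grad.
rewrite !E !dot3 !rotE /grad !mxE /=.
move: (pd 0 f _) (pd 1 f _) (pd 2 f _) => a b c.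
by split; first split; ring.
Qed.

Definition rotated_field t F x := rot (- t) (F (rot t x)).

Lemma rotated_fieldE t F x :
  ((rotated_field t F x 0 0 = (cos t * F (rot t x) 0 0 + sin t * F (rot t x) 0 1)%R) *
  (rotated_field t F x 0 1 = (- sin t * F (rot t x) 0 0 + cos t * F (rot t x) 0 1)%R) *
  (rotated_field t F x 0 2 = F (rot t x) 0 2))%type.
Proof.
by rewrite /rotated_field !rotE cosN sinN; split; first split; ring.
Qed.

Lemma pd_rotated_field t F x i : differentiable F (rot t x) ->
  ((pd i (fun y => rotated_field t F y 0 0) x =
    (cos t * pd i (fun y => F (rot t y) 0 0) x + sin t * pd i (fun y => F (rot t y) 0 1) x)%R) *
  (pd i (fun y => rotated_field t F y 0 1) x =
    (- sin t * pd i (fun y => F (rot t y) 0 0) x + cos t * pd i (fun y => F (rot t y) 0 1) x)%R) *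
  (pd i (fun y => rotated_field t F y 0 2) x = pd i (fun y => F (rot t y) 0 2) x))%type.
Proof.
move=> dF.
have d k : differentiable (fun y => F (rot t y) 0 k) x.
  apply: (@differentiable_comp _ _ _ _ (rot t) (fun z => F z 0 k)).
    exact: differentiable_rot.
  by move: k; apply/differentiable_rVP.
split; first split.
- by rewrite -pd_lin//; congr pd; apply/funext => y; rewrite rotated_fieldE.
- by rewrite -pd_lin//; congr pd; apply/funext => y; rewrite rotated_fieldE.
- by congr pd; apply/funext => y; rewrite rotated_fieldE.
Qed.

Lemma cos2Dsin2_mul t : cos t * cos t + sin t * sin t = 1 :> R.
Proof. by rewrite -(cos2Dsin2 t) !expr2. Qed.

Lemma div_rotated_field t F x : differentiable F (rot t x) ->
  div (rotated_field t F) x = div F (rot t x).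
Proof.
move=> dF; have /differentiable_rVP dFi := dF.
rewrite !divE !pd_rotated_field// !(pd_rot (f := fun z => F z 0 _))//.
have := cos2Dsin2_mul t; move: (cos t) (sin t) => c s h.
move: (pd 0 (fun z => F z 0 0) _) (pd 1 (fun z => F z 0 0) _).
move: (pd 0 (fun z => F z 0 1) _) (pd 1 (fun z => F z 0 1) _) (pd 2 _ _).
move=> a b e a' b'.
transitivity ((c * c + s * s) * a' + (c * c + s * s) * b + e); first by ring.
by rewrite h !mul1r.
Qed.

Lemma curl_rotated_field t F x : differentiable F (rot t x) ->
  curl (rotated_field t F) x = rot (- t) (curl F (rot t x)).
Proof.
move=> dF; have /differentiable_rVP dFi := dF.
apply: row3P; rewrite !rotE !curlE !pd_rotated_field// !(pd_rot (f := fun z => F z 0 _))// ?cosN ?sinN.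
- move: (pd 0 _ _) (pd 1 _ _) (pd 2 (fun z => F z 0 0) _) (pd 2 (fun z => F z 0 1) _).
  by move=> a b e f; ring.
- move: (pd 0 _ _) (pd 1 _ _) (pd 2 (fun z => F z 0 0) _) (pd 2 (fun z => F z 0 1) _).
  by move=> a b e f; ring.
have := cos2Dsin2_mul t; move: (cos t) (sin t) => c s h.
move: (pd 0 (fun z => F z 0 0) _) (pd 1 (fun z => F z 0 0) _).
move: (pd 0 (fun z => F z 0 1) _) (pd 1 (fun z => F z 0 1) _).
move=> a b a' b'.
transitivity ((c * c + s * s) * (a - b')); first by ring.
by rewrite h mul1r.
Qed.

(** The field d/dtheta generates the rotations. *)
Lemma is_derive_rot0 x : is_derive (0 : R) 1 (fun t : R => rot t x) (d_theta x).
Proof.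
have dc i : is_derive (0 : R) 1 (fun t : R => rot t x 0 i) (d_theta x 0 i).
  have dco (a : R) : is_derive (0 : R) 1 (fun t => cos t * a) (- sin 0 * a).
    apply: is_derive_eq.
    by rewrite /GRing.scale /= mulr0 add0r mulrC.
  have dsi (a : R) : is_derive (0 : R) 1 (fun t => sin t * a) (cos 0 * a).
    apply: is_derive_eq.
    by rewrite /GRing.scale /= mulr0 add0r mulrC.
  move: i; elim/ord3_ind; rewrite /d_theta vec3E; under eq_fun do rewrite rotE.
  - by apply: is_derive_eq; rewrite sin0 cos0; ring.
  - by apply: is_derive_eq; rewrite sin0 cos0; ring.
  - exact: is_derive_cst.
have d : derivable (fun t : R => rot t x) 0 1.
  by apply/derivable_mxP => i j; rewrite ord1; have [] := dc j.
apply: DeriveDef => //; rewrite derive_mx//; apply/rowP => j; rewrite mxE.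
by have [_ ->] := dc j.
Qed.

End vector_calculus.

(** * Beltrami fields *)

Section beltrami_fields.
Variable R : realType.
Variable Omega : set 'rV[R]_3.
Hypothesis hOmega : toroidal_domain Omega.

Let oO : open Omega. Proof. by have [] := hOmega. Qed.
Let OcO : Omega `<=` closure Omega. Proof. exact: subset_closure. Qed.

Lemma beltrami_differentiable l v x : beltrami Omega l v -> Omega x ->
  differentiable v x.
Proof. by move=> [sv _ _ _] Ox; exact: smooth_differentiable oO OcO Ox sv. Qed.

Lemma beltrami_linear l (a b : R) v w : beltrami Omega l v -> beltrami Omega l w ->
  beltrami Omega l (fun x => a *: v x + b *: w x).
Proof.
move=> bv bw; have [sv cv dv tv] := bv; have [sw cw dw tw] := bw; split.
- by apply: smoothD; apply: smoothZ => //; exact: smooth_cst.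
- move=> x Ox; rewrite curl_linear; [|exact: beltrami_differentiable bv Ox|exact: beltrami_differentiable bw Ox].
  by rewrite cv// cw// scalerDr !scalerA ![l * _]mulrC.
- move=> x Ox; rewrite div_linear; [|exact: beltrami_differentiable bv Ox|exact: beltrami_differentiable bw Ox].
  by rewrite dv// dw// !mulr0 addr0.
- by move=> p nu pn; rewrite dotDl !dotZl tv// tw// !mulr0 addr0.
Qed.

Lemma beltrami_rotated l v t : beltrami Omega l v ->
  beltrami Omega l (rotated_field t v).
Proof.
move=> bv; have [sv cv dv tv] := bv.
have O t' x : Omega x -> Omega (rot t' x) := @Omega_rot _ _ hOmega t' x.
split.
- apply: (smooth_comp_rV (A' := setT)) (smooth_rot _ _) => //.
  apply: (smooth_comp_rV (A' := closure Omega)) (smooth_rot _ _) sv.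
  by move=> x; exact: closure_rot.
- move=> x Ox; rewrite curl_rotated_field; last exact: beltrami_differentiable bv (O t x Ox).
  rewrite cv; last exact: O.
  have := rotZD (- t) l (v (rot t x)) 0; rewrite !addr0 => ->.
  by rewrite (_ : rot _ 0 = 0) ?addr0//; apply/eqP; rewrite rot_eq0.
- move=> x Ox; rewrite div_rotated_field; first exact/dv/O.
  exact: beltrami_differentiable bv (O t x Ox).
- exact: tangent_rot.
Qed.

(** The pressure is a first integral, hence constant, and B x curl B = 0. As B has
    no zero, curl B = f B with f smooth up to the boundary, and
    0 = div (curl B) = B . grad f + f div B = B . grad f, so that f is constant
    too. *)
Lemma mhs_beltrami (B : 'rV[R]_3 -> 'rV[R]_3) : mhs_equilibrium Omega B ->
  smooth (closure Omega) B -> (forall x, closure Omega x -> B x != 0) ->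
  (forall P, smooth (closure Omega) P ->
    (forall x, Omega x -> dot (B x) (grad P x) = 0) ->
    forall x y, closure Omega x -> closure Omega y -> P x = P y) ->
  exists l, beltrami Omega l B.
Proof.
move=> [[P [sP PE]] dB tB] sB B0 fi.
have dP x : Omega x -> dot (B x) (grad P x) = 0.
  move=> Ox; have /eqP := PE x Ox; rewrite addrC addr_eq0 => /eqP ->.
  by rewrite -scaleN1r dotZr dot_cross mulr0.
have Pcst := fi P sP dP.
have BxC x : Omega x -> cross (B x) (curl B x) = 0.
  move=> Ox; have := PE x Ox; suff -> : grad P x = 0 by rewrite addr0.
  apply/rowP => i; rewrite !mxE /pd -(derive_cst (P x) x (delta_mx 0 i)).
  apply: near_eq_derive; apply: (open_near_eq oO) => // y Oy.
  by apply: Pcst; exact: OcO.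
have [U [B' [oU cU kB BB]]] := sB.
pose f x := dot (curl B' x) (B' x) / dot (B' x) (B' x).
have B'0 x : closure Omega x -> dot (B' x) (B' x) != 0.
  by move=> cx; rewrite dot_eq0 BB//; exact: B0.
have kBi n i : Ck U n (fun y => B' y 0 i) := proj1 (Ck_rVP n _ oU) (kB n) i.
have sB' : smooth (closure Omega) B' by exists U, B'.
have kC n : Ck U n (curl B').
  apply/Ck_rVP => // i; apply: (@Ck_ext _ _ _ _ _ (fun x =>
     pd (i + 1) (fun y => B' y 0 (i + 2)) x + - pd (i + 2) (fun y => B' y 0 (i + 1)) x)) => //.
    by move=> x _; rewrite mxE.
  apply: CkD => //; first by have [_] := kBi n.+1 (i + 2); apply.
  by apply: CkN => //; have [_] := kBi n.+1 (i + 1); apply.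
have sC : smooth (closure Omega) (curl B') by exists U, (curl B').
have sf : smooth (closure Omega) f.
  apply: smoothM; first exact: smooth_dot.
  by apply: smoothV; [exact: B'0|exact: smooth_dot].
have OU : Omega `<=` U by move=> x /OcO/cU.
have BB' x : Omega x -> B' x = B x by move=> /OcO/BB.
have CE x : Omega x -> curl B' x = curl B x.
  move=> Ox; apply/rowP => i; rewrite !mxE.
  by congr (_ - _); apply: near_eq_derive; apply: (open_near_eq oO) => // y Oy; rewrite BB'.
have dE x : Omega x -> div B' x = 0.
  move=> Ox; rewrite -(dB x Ox) /div; apply: eq_bigr => i _.
  by apply: near_eq_derive; apply: (open_near_eq oO) => // y Oy; rewrite BB'.
have CfB x : Omega x -> curl B' x = f x *: B' x.
  move=> Ox; apply: cross_eq0; first by rewrite BB' ?B0//; exact: OcO.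
  by rewrite CE// BB'// BxC.
have df x : Omega x -> dot (B x) (grad f x) = 0.
  move=> Ox; have := div_curl oU (OU _ Ox) (kB 2).
  have -> : div (curl B') x = div (fun y => f y *: B' y) x.
    apply: eq_bigr => i _; apply: near_eq_derive; apply: (open_near_eq oO) => // y Oy.
    by rewrite CfB.
  rewrite divZ ?dE ?mulr0 ?addr0 ?BB'//.
    exact: smooth_differentiable oO OcO Ox sf.
  exact: smooth_differentiable oO OcO Ox sB'.
have fcst := fi f sf df.
have [x0 Ox0] := Omega_nonempty hOmega.
exists (f x0); split => // x Ox.
rewrite -CE// CfB// BB'//; congr (_ *: _).
by apply: fcst; exact: OcO.
Qed.

(** The tangency holds because rotations preserve the boundary: a defining
    function near p vanishes along t |-> rot t p, whose velocity is d/dtheta. *)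
Lemma beltrami_harmonic_field : beltrami Omega 0 (@harmonic_field R).
Proof.
have sr : smooth (closure Omega) (fun x : 'rV[R]_3 => (rsq x)^-1).
  by apply: smoothV (smooth_rsq _) => x /(rsq_gt0 hOmega) /gt_eqF ->.
have sh : smooth (closure Omega) (@harmonic_field R).
  by apply: smoothZ => //; exact: smooth_d_theta.
have dco (i : 'I_3) x : differentiable (fun y : 'rV[R]_3 => y 0 i) x by exact: differentiable_coord.
have pco (i j : 'I_3) x : pd i (fun y : 'rV[R]_3 => y 0 j) x = (i == j)%:R.
  by rewrite /pd derive_coord mxE eqxx eq_sym.
have r0 x : Omega x -> rsq x != 0 by move=> /OcO /(rsq_gt0 hOmega) /gt_eqF ->.
have dr x : Omega x -> differentiable (fun y : 'rV[R]_3 => (rsq y)^-1) x.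
  by move=> Ox; exact: smooth_differentiable oO OcO Ox sr.
have pr i x : Omega x -> pd i (fun y : 'rV[R]_3 => (rsq y)^-1) x =
    - (rsq x) ^- 2 * (2 * x 0 0 * (i == 0)%:R + 2 * x 0 1 * (i == 1)%:R).
  move=> Ox; rewrite /pd deriveV ?r0//; last first.
    by apply: diff_derivable; exact: smooth_differentiable oO OcO Ox (smooth_rsq _).
  rewrite /GRing.scale /=; congr (_ * _).
  rewrite -!/(pd _ _ _).
  have -> : (@rsq R) = (fun y => y 0 0 * y 0 0 + y 0 1 * y 0 1).
    by apply/funext => y; rewrite /rsq !expr2.
  have dm k : differentiable (fun y : 'rV[R]_3 => y 0 k * y 0 k) x.
    by apply: differentiableM; exact: dco.
  by rewrite pdD// !pdM// !pco; ring.
have h0 : (fun y : 'rV[R]_3 => harmonic_field y 0 0) = (fun y => (rsq y)^-1 * (-1 * y 0 1)).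
  by apply/funext => y; rewrite /harmonic_field mxE /d_theta vec3E mulN1r.
have h1 : (fun y : 'rV[R]_3 => harmonic_field y 0 1) = (fun y => (rsq y)^-1 * y 0 0).
  by apply/funext => y; rewrite /harmonic_field mxE /d_theta vec3E.
have h2 : (fun y : 'rV[R]_3 => harmonic_field y 0 2) = (fun y => 0).
  by apply/funext => y; rewrite /harmonic_field mxE /d_theta vec3E mulr0.
have p0 i x : Omega x -> pd i (fun y : 'rV[R]_3 => harmonic_field y 0 0) x =
    (rsq x)^-1 * - (i == 1)%:R + x 0 1 * (rsq x) ^- 2 * (2 * x 0 0 * (i == 0)%:R + 2 * x 0 1 * (i == 1)%:R).
  move=> Ox; rewrite h0 pdM; [|exact: dr|exact: (@differentiableZ _ _ _ (fun y : 'rV[R]_3 => y 0 1))].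
  by rewrite pdZ// pr// pco; ring.
have p1 i x : Omega x -> pd i (fun y : 'rV[R]_3 => harmonic_field y 0 1) x =
    (rsq x)^-1 * (i == 0)%:R - x 0 0 * (rsq x) ^- 2 * (2 * x 0 0 * (i == 0)%:R + 2 * x 0 1 * (i == 1)%:R).
  by move=> Ox; rewrite h1 pdM ?pr ?pco; [ring|exact: Ox|exact: dr|exact: dco].
have p2 i x : pd i (fun y : 'rV[R]_3 => harmonic_field y 0 2) x = 0.
  by rewrite h2 /pd derive_cst.
split=> //.
- move=> x Ox; rewrite scale0r; apply: row3P; rewrite curlE ?p0 ?p1 ?p2// mxE /=.
  + by ring.
  + by ring.
  + have := r0 x Ox; rewrite /rsq => rn0; by field.
- move=> x Ox; rewrite divE p0// p1// p2 /=; ring.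
apply/tangent_to_boundaryP => p g bp dg.
have [U [oU Up kg gU]] := defining_function_sign oO dg bp.
have [cp nO] := proj1 (bdryE p oO) bp.
rewrite /harmonic_field dotZl; apply/eqP; rewrite mulf_eq0; apply/orP; right; apply/eqP.
have dgp : differentiable g p by have [d _] := kg 1; exact: d.
rewrite -derive_dot_grad//.
have dgp0 : differentiable g (rot 0 p) by rewrite rot0.
have dp := is_derive_path (is_derive_rot0 p) dgp0.
have [_ Dp] := dp; rewrite rot0 in Dp; rewrite -Dp.
transitivity ('D_1 (cst 0 : R -> R) (0 : R)); last exact: derive_cst.
have crot : {for (0 : R), continuous (fun t : R => rot t p)}.
  apply: differentiable_continuous; apply/derivable1_diffP.
  by have [] := is_derive_rot0 p.
apply: near_eq_derive.
have nU : nbhs (rot 0 p) U by rewrite rot0; exact: open_nbhs_nbhs.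
have nrU : \forall t \near (0 : R), U (rot t p) by exact: (crot _ nU).
near=> t; have Ut : U (rot t p) by near: t.
have [_ g0] := gU _ Ut (closure_rot hOmega cp); apply: g0.
by move=> /(@Omega_rot _ _ hOmega (- t)); rewrite rotK.
Unshelve. all: by end_near. Qed.

Lemma grad_rsq x : grad (@rsq R) x = vec3 (2 * x 0 0) (2 * x 0 1) 0.
Proof.
have dco (i : 'I_3) : differentiable (fun y : 'rV[R]_3 => y 0 i) x by exact: differentiable_coord.
have pco (i j : 'I_3) : pd i (fun y : 'rV[R]_3 => y 0 j) x = (i == j)%:R.
  by rewrite /pd derive_coord mxE eqxx eq_sym.
have -> : (@rsq R) = (fun y => y 0 0 * y 0 0 + y 0 1 * y 0 1).
  by apply/funext => y; rewrite /rsq !expr2.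
have dm k : differentiable (fun y : 'rV[R]_3 => y 0 k * y 0 k) x.
  by apply: differentiableM; exact: dco.
have E i : pd i (fun y : 'rV[R]_3 => y 0 0 * y 0 0 + y 0 1 * y 0 1) x =
   2 * x 0 0 * (i == 0)%:R + 2 * x 0 1 * (i == 1)%:R.
  by rewrite pdD// !pdM// !pco; ring.
by apply: row3P; rewrite mxE E vec3E /=; ring.
Qed.

Lemma rsq_not_constant : ~ (forall x y, closure Omega x -> closure Omega y ->
  rsq x = rsq y).
Proof.
move=> rc; have [x Ox] := Omega_nonempty hOmega.
have : grad (@rsq R) x = 0.
  apply/rowP => i; rewrite !mxE /pd -(derive_cst (rsq x) x (delta_mx 0 i)).
  apply: near_eq_derive; apply: (open_near_eq oO) => // y Oy.
  by apply: rc; exact: OcO.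
have := rsq_gt0 hOmega (OcO Ox); rewrite grad_rsq => r0 /rowP h.
move: (h 0) (h 1) r0; rewrite !vec3E !mxE /rsq => /eqP + /eqP.
by rewrite !mulf_eq0 !pnatr_eq0 /= => /eqP -> /eqP ->; rewrite expr0n addr0 ltxx.
Qed.

Section axisymmetric.
Variables (l : R) (B : 'rV[R]_3 -> 'rV[R]_3).
Hypothesis bB : beltrami Omega l B.
Hypothesis symB : forall t x, Omega x -> rotated_field t B x = B x.

(** B . d_theta, that is r^2 times the component B^theta. *)
Definition axial_momentum (x : 'rV[R]_3) : R := - x 0 1 * B x 0 0 + x 0 0 * B x 0 1.

Lemma smooth_axial_momentum : smooth (closure Omega) axial_momentum.
Proof.
have [/smooth_rVP sB _ _ _] := bB.
apply: smoothD; apply: smoothM => //; last exact: smooth_coord.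
by apply: smoothN; exact: smooth_coord.
Qed.

(** Differentiate B (rot t x) = rot t (B x) at t = 0; d_theta is linear, and it
    is the derivative of rot t at t = 0. *)
Lemma axisymmetric_derivative x i : Omega x ->
  - x 0 1 * pd 0 (fun y => B y 0 i) x + x 0 0 * pd 1 (fun y => B y 0 i) x =
  d_theta (B x) 0 i.
Proof.
move=> Ox; have dB : differentiable B x := beltrami_differentiable bB Ox.
have dB0 : differentiable B (rot 0 x) by rewrite rot0.
have d1 := is_derive_path (is_derive_rot0 x) dB0.
have d2 := is_derive_rot0 (B x).
have E : (fun t : R => B (rot t x)) = (fun t => rot t (B x)).
  by apply/funext => t; rewrite -(symB t Ox) /rotated_field rotNK.
rewrite E in d1; have [_ D1] := d1; have [_ D2] := d2.
have : 'D_(d_theta x) B x = d_theta (B x) by rewrite -D2 D1 rot0.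
move=> /rowP /(_ i) <-.
rewrite derive_rV// derive_dot_grad; last by move: i; apply/differentiable_rVP.
by rewrite dot3 /d_theta !vec3E /grad !mxE; ring.
Qed.

(** The right-hand side is d_theta x curl B. For the one-form dual to an
    axisymmetric B, this is Cartan's formula for the Lie derivative along
    d_theta. *)
Lemma grad_axial_momentum x : Omega x -> grad axial_momentum x =
  l *: vec3 (x 0 0 * B x 0 2) (x 0 1 * B x 0 2)
            (- (x 0 0 * B x 0 0 + x 0 1 * B x 0 1)).
Proof.
move=> Ox; have [_ cB _ _] := bB.
have /differentiable_rVP dB := beltrami_differentiable bB Ox.
have pco (i j : 'I_3) : pd i (fun y : 'rV[R]_3 => y 0 j) x = (i == j)%:R.
  by rewrite /pd derive_coord mxE eqxx eq_sym.
have dco (i : 'I_3) : differentiable (fun y : 'rV[R]_3 => y 0 i) x by exact: differentiable_coord.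
have dN : differentiable (fun y : 'rV[R]_3 => - y 0 1) x.
  by apply: (@differentiableN _ _ _ (fun y : 'rV[R]_3 => y 0 1)).
have pN i : pd i (fun y : 'rV[R]_3 => - y 0 1) x = - (i == 1)%:R.
  rewrite -pco /pd (@deriveN _ _ _ (fun y : 'rV[R]_3 => y 0 1))//.
  exact: diff_derivable.
have E i : pd i axial_momentum x =
    (- x 0 1 * pd i (fun y => B y 0 0) x - B x 0 0 * (i == 1)%:R) +
    (x 0 0 * pd i (fun y => B y 0 1) x + B x 0 1 * (i == 0)%:R).
  rewrite /axial_momentum pdD; first last.
  - by apply: differentiableM.
  - by apply: differentiableM.
  by rewrite pdM// pdM// pN pco mulrN.
have := axisymmetric_derivative 0 Ox; have := axisymmetric_derivative 1 Ox.
have := axisymmetric_derivative 2 Ox; rewrite !vec3E.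
have := cB x Ox => /rowP cx; move: (cx 0) (cx 1) (cx 2).
rewrite !curlE !mxE => c0 c1 c2 a2 a1 a0.
apply: row3P; rewrite mxE E [RHS]mxE vec3E /=.
- rewrite mulr0 mulr1 subr0 mulrCA -c2 -[B x 0 1]opprK -a0; ring.
- rewrite mulr0 mulr1 addr0 mulrCA -c2 -a1; ring.
- rewrite !mulr0 addr0 subr0 mulrN mulrDr !(mulrCA l) -c0 -c1.
  move: a2; move: (pd 0 _ x) (pd 1 (fun y => B y 0 2) x).
  move: (pd 2 (fun y => B y 0 0) x) (pd 2 (fun y => B y 0 1) x).
  by move=> p q s t; lra.
Qed.

Lemma axial_momentum_first_integral x : Omega x ->
  dot (B x) (grad axial_momentum x) = 0.
Proof.
by move=> Ox; rewrite grad_axial_momentum// dotZr dot3 !vec3E; ring.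
Qed.

(** Here l (d_theta x B) = 0, so that B has no component along grad r^2. *)
Lemma axisymmetric_beltrami_toroidal : l != 0 ->
  (forall x y, closure Omega x -> closure Omega y ->
    axial_momentum x = axial_momentum y) ->
  forall x, Omega x -> dot (B x) (grad (@rsq R) x) = 0.
Proof.
move=> l0 wc x Ox.
have : grad axial_momentum x = 0.
  apply/rowP => i; rewrite !mxE /pd -(derive_cst (axial_momentum x) x (delta_mx 0 i)).
  apply: near_eq_derive; apply: (open_near_eq oO) => // y Oy.
  by apply: wc; exact: OcO.
rewrite grad_axial_momentum// => /rowP /(_ 2); rewrite !mxE /= => /eqP.
rewrite mulf_eq0 (negbTE l0) oppr_eq0 /= => /eqP h.
rewrite grad_rsq dot3 !vec3E.
transitivity (2 * (x 0 0 * B x 0 0 + x 0 1 * B x 0 1)); first by ring.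
by rewrite h mulr0.
Qed.

End axisymmetric.

End beltrami_fields.

(** * Volume integrals *)

Section volume.
Variable R : realType.

Definition point3 (p : (R * R) * R) : 'rV[R]_3 := vec3 p.1.1 p.1.2 p.2.

Local Notation lambda1 := (@lebesgue_measure R).
Local Notation lambda3 := ((lambda1 \x lambda1) \x lambda1)%E.

Definition ratitv (q : rat * rat) : set R := `]ratr q.1, ratr q.2[%classic.

Definition ratbox (q : (rat * rat) * (rat * rat) * (rat * rat)) :
    set ((R * R) * R) :=
  (ratitv q.1.1 `*` ratitv q.1.2) `*` ratitv q.2.

Lemma measurable_ratbox q : measurable (ratbox q).
Proof. by apply: measurableX; [apply: measurableX|]; exact: measurable_itv. Qed.

Lemma open_ratbox (O : set 'rV[R]_3) p : open O -> O (point3 p) ->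
  exists q, ratbox q p /\ ratbox q `<=` point3 @^-1` O.
Proof.
move=> oO Op.
have /nbhs_ballP [r /= r0 rO] : nbhs (point3 p) O by exact: open_nbhs_nbhs.
have near_rat (x : R) : exists q : rat * rat, ratitv q x /\
    forall y, ratitv q y -> `|x - y| < r.
  have /rat_in_itvoo [a] : x - r < x by rewrite ltrBlDr ltrDl.
  rewrite in_itv /= => /andP[xa ax].
  have /rat_in_itvoo [b] : x < x + r by rewrite ltrDl.
  rewrite in_itv /= => /andP[xb bx].
  exists (a, b); split; first by rewrite /ratitv /= in_itv /= ax xb.
  move=> y; rewrite /ratitv /= in_itv /= => /andP[ay yb].
  by rewrite ltr_norml; apply/andP; split; lra.
have [q0 [p0 h0]] := near_rat p.1.1.
have [q1 [p1 h1]] := near_rat p.1.2.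
have [q2 [p2 h2]] := near_rat p.2.
exists (q0, q1, q2); split=> // -[[y0 y1] y2] [[/= b0 b1] b2].
apply: rO; split=> // i; rewrite (ord1 i); elim/ord3_ind;
  rewrite /point3 !vec3E /ball /=; [exact: h0|exact: h1|exact: h2].
Qed.

(** An open set is a countable union of rational boxes, which belong to the
    product sigma-algebra. *)
Lemma measurable_point3_preimage (O : set 'rV[R]_3) : open O ->
  measurable (point3 @^-1` O).
Proof.
move=> oO.
pose F q := if `[< ratbox q `<=` point3 @^-1` O >] then ratbox q else set0.
have -> : point3 @^-1` O = \bigcup_q F q.
  apply/seteqP; split=> [p Op|p [q _]].
    have [q [qp qO]] := open_ratbox oO Op; exists q => //.
    by rewrite /F asboolT.
  by rewrite /F; case: asboolP => // qO; exact: qO.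
apply: countable_bigcupT_measurable => // q.
by rewrite /F; case: asboolP => // _; exact: measurable_ratbox.
Qed.

Lemma ratbox_measure_gt0 q p : ratbox q p -> (0 < lambda3 (ratbox q))%E.
Proof.
have itv_gt0 (a : rat * rat) (x : R) : ratitv a x -> (0 < lambda1 (ratitv a))%E.
  rewrite /ratitv /= in_itv /= => /andP[ax xa].
  rewrite lebesgue_measure_itv /= lte_fin (lt_trans ax xa).
  by rewrite -EFinB lte_fin subr_gt0 (lt_trans ax xa).
move=> [[b0 b1] b2].
have mi a : measurable (ratitv a) by exact: measurable_itv.
have mii a b : measurable (ratitv a `*` ratitv b) by apply: measurableX; exact: mi.
rewrite /ratbox (@product_measure1E _ _ _ _ _ (lambda1 \x lambda1)%E lambda1 _ _ (mii _ _) (mi _)).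
rewrite [X in (X * _)%E](@product_measure1E _ _ _ _ _ lambda1 lambda1 _ _ (mi _) (mi _)).
by rewrite !mule_gt0//; [exact: itv_gt0 b0|exact: itv_gt0 b1|exact: itv_gt0 b2].
Qed.

Variable Omega : set 'rV[R]_3.
Hypothesis hOmega : toroidal_domain Omega.

Let oO : open Omega. Proof. by have [] := hOmega. Qed.
Let OcO : Omega `<=` closure Omega. Proof. exact: subset_closure. Qed.
Let A := point3 @^-1` Omega.
Let mA : measurable A. Proof. exact: measurable_point3_preimage. Qed.

Lemma finite_volume : (lambda3 A < +oo)%E.
Proof.
have [M hM] := closure_bounded hOmega.
pose I := `[- M, M]%classic : set R.
have mI : measurable I by exact: measurable_itv.
have mII : measurable (I `*` I) by apply: measurableX; exact: mI.
have AI : A `<=` (I `*` I) `*` I.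
  move=> -[[a b] c] /OcO /hM h.
  by split; first split; rewrite /I /= in_itv /= -ler_norml;
    [have := h 0|have := h 1|have := h 2]; rewrite /point3 vec3E.
apply: (@le_lt_trans _ _ (lambda3 ((I `*` I) `*` I))).
  by apply: le_measure; rewrite ?inE//; exact: measurableX mII mI.
rewrite (@product_measure1E _ _ _ _ _ (lambda1 \x lambda1)%E lambda1 _ _ mII mI).
rewrite [X in (X * _)%E](@product_measure1E _ _ _ _ _ lambda1 lambda1 _ _ mI mI).
have fI : (lambda1 I < +oo)%E.
  by rewrite /I lebesgue_measure_itv /=; case: ifP => // _; rewrite ltry.
have finI : lambda1 I \is a fin_num by rewrite ge0_fin_numE.
change (lambda1 I * lambda1 I * lambda1 I < +oo)%E.
by rewrite -(fineK finI) -!EFinM ltry.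
Qed.

Lemma measurable_smooth (f : 'rV[R]_3 -> R) : smooth (closure Omega) f ->
  measurable_fun A (f \o point3).
Proof.
move=> sf; apply: (measurability _ (measurable_realfun.RGenOInfty.measurableE R)).
move=> /= _ [_ [a ->] <-].
have -> : A `&` (f \o point3) @^-1` `]a, +oo[ =
    point3 @^-1` (Omega `&` f @^-1` [set y | a < y]).
  by apply/seteqP; split=> p [Op]; rewrite /= ?in_itv /= ?andbT => fp; split=> //;
    rewrite /= in_itv /= andbT.
apply: measurable_point3_preimage.
by apply: open_setI_preim (smooth_Ck 0 oO OcO sf) => //; exact: open_gt.
Qed.

Lemma smooth_integrable (f : 'rV[R]_3 -> R) : smooth (closure Omega) f ->
  lambda3.-integrable A (EFin \o (f \o point3)).
Proof.
move=> sf; apply: measurable_bounded_integrable => //.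
- exact: finite_volume.
- exact: measurable_smooth.
have [M hM] := smooth_bounded hOmega sf.
exists M; split; first exact: num_real.
by move=> y My p Op /=; rewrite (le_trans _ (ltW My))// hM//; exact: OcO.
Qed.

Lemma volume_integral_fin f : smooth (closure Omega) f ->
  volume_integral Omega f \is a fin_num.
Proof. by move=> /smooth_integrable; exact: integrable_fin_num. Qed.

Lemma volume_integral_linear (a b : R) f g : smooth (closure Omega) f ->
  smooth (closure Omega) g ->
  volume_integral Omega (fun x => a * f x + b * g x) =
  (a%:E * volume_integral Omega f + b%:E * volume_integral Omega g)%E.
Proof.
move=> /smooth_integrable sf /smooth_integrable sg.
rewrite /volume_integral -!integralZl// -integralD//; try exact: integrableZl.
Qed.

(** A positive value of f persists on a rational box, which has positive
    volume. *)
Lemma volume_integral_eq0 (f : 'rV[R]_3 -> R) : smooth (closure Omega) f ->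
  (forall x, Omega x -> 0 <= f x) -> volume_integral Omega f = 0%E ->
  forall x, Omega x -> f x = 0.
Proof.
move=> sf f0 I0 x Ox; apply/eqP; rewrite eq_le f0// andbT leNgt; apply/negP => fx.
have /measurable_int mf := smooth_integrable sf.
have aeE := @ae_eq_integral_abs _ _ _ lambda3 A mA (EFin \o (f \o point3)) mf.
have [|N [mN N0 fN]] := proj1 aeE.
  rewrite -[RHS]I0; apply: eq_integral => p /set_mem Op /=.
  by rewrite ger0_norm// f0.
have oO' : open (Omega `&` f @^-1` [set y : R | 0 < y]).
  by apply: open_setI_preim (smooth_Ck 0 oO OcO sf) => //; exact: open_gt.
have xE : point3 (x 0 0, x 0 1, x 0 2) = x.
  by apply: row3P; rewrite /point3 vec3E.
have [|q [qp qO]] := @open_ratbox _ (x 0 0, x 0 1, x 0 2) oO'; first by rewrite xE.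
have := ratbox_measure_gt0 qp; apply/negP; rewrite -leNgt -N0.
apply: le_measure; rewrite ?inE//; first exact: measurable_ratbox.
move=> p /qO [Op fp]; apply: fN => /(_ Op) /= [fp0].
by move: fp; rewrite /= fp0 ltxx.
Qed.

End volume.

(** * The curl spectrum *)

Section spectral.
Variable R : realType.
Variable Omega : set 'rV[R]_3.
Hypothesis hOmega : toroidal_domain Omega.
Implicit Types (u v w : 'rV[R]_3 -> 'rV[R]_3).

Let oO : open Omega. Proof. by have [] := hOmega. Qed.
Let OcO : Omega `<=` closure Omega. Proof. exact: subset_closure. Qed.
Local Notation smoothc := (smooth (closure Omega)).

Lemma smooth_eq_on_closure (W : normedModType R) (v w : 'rV[R]_3 -> W) : smoothc v -> smoothc w ->
  (forall x, Omega x -> v x = w x) -> forall x, closure Omega x -> v x = w x.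
Proof.
move=> [U [v' [oU cU kv vv]]] [U' [w' [oU' cU' kw ww]]] vw x cx.
rewrite -vv// -ww//; apply: (@eq_on_closure _ _ Omega v' w' x) => //.
- by apply: (kv 0); exact: cU.
- by apply: (kw 0); exact: cU'.
by move=> y Oy; rewrite vv ?ww ?vw//; exact: OcO.
Qed.

Lemma smooth_max (f : 'rV[R]_3 -> R) : smoothc f ->
  exists2 c, closure Omega c & forall x, closure Omega x -> f x <= f c.
Proof.
move=> [U [g [oU cU kg gf]]].
have [||c cc gc] := @EVT_max_rV R 3 g (closure Omega) _ (closure_compact hOmega).
- by have [x Ox] := Omega_nonempty hOmega; exists x; exact: OcO.
- by apply: continuous_in_subspaceT => x /set_mem /cU; exact: (kg 0).
by exists c; [exact: set_mem|move=> x cx; rewrite -!gf//; [exact/gc/mem_set|exact: set_mem]].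
Qed.

Definition ip v w : R := fine (inner_product Omega v w).

Lemma ipE v w : smoothc v -> smoothc w -> inner_product Omega v w = (ip v w)%:E.
Proof.
move=> sv sw; rewrite fineK//; apply: (volume_integral_fin hOmega).
exact: smooth_dot.
Qed.

Lemma ip_linear (a b : R) u v w : smoothc u -> smoothc v -> smoothc w ->
  ip (fun x => a *: u x + b *: v x) w = a * ip u w + b * ip v w.
Proof.
move=> su sv sw; apply: EFin_inj; rewrite -ipE//; last first.
  by apply: smoothD; apply: smoothZ => //; exact: smooth_cst.
rewrite EFinD !EFinM -!ipE// /inner_product.
rewrite -(volume_integral_linear hOmega); try exact: smooth_dot.
by congr volume_integral; apply/funext => x; rewrite dotDl !dotZl.
Qed.

Lemma ip_sym v w : ip v w = ip w v.
Proof.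
by rewrite /ip /inner_product; congr (fine (volume_integral _ _));
  apply/funext => x; rewrite dot_sym.
Qed.

Lemma ip_eq0 v : smoothc v -> ip v v = 0 -> forall x, Omega x -> v x = 0.
Proof.
move=> sv v0 x Ox; apply/eqP; rewrite -dot_eq0; apply/eqP; move: x Ox.
apply: (volume_integral_eq0 hOmega).
- exact: smooth_dot.
- by move=> x _; exact: dot_ge0.
- by rewrite -/(inner_product Omega v v) ipE// v0.
Qed.

Lemma ip_lincomb d (a : R) u (c : 'I_d -> R) (v : 'I_d -> 'rV[R]_3 -> 'rV[R]_3) w :
  smoothc u -> (forall k, smoothc (v k)) -> smoothc w ->
  ip (fun x => a *: u x + \sum_k c k *: v k x) w = a * ip u w + \sum_k c k * ip (v k) w.
Proof.
move=> su sv sw.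
have ssum s : smoothc (fun x => \sum_(k <- s) c k *: v k x).
  by apply: smooth_sum => k; apply: smoothZ => //; exact: smooth_cst.
have E s : ip (fun x => \sum_(k <- s) c k *: v k x) w = \sum_(k <- s) c k * ip (v k) w.
  elim: s => [|k s IH].
    have := ip_linear 0 0 su su sw; rewrite big_nil !mul0r addr0 => <-.
    by congr ip; apply/funext => x; rewrite big_nil !scale0r addr0.
  rewrite big_cons -IH -[X in _ = _ + X]mul1r -ip_linear//.
  by congr ip; apply/funext => x; rewrite big_cons scale1r.
rewrite -E -[X in _ = _ + X]mul1r -ip_linear//.
by congr ip; apply/funext => x; rewrite scale1r.
Qed.

Lemma beltrami_lincomb d l (a : R) u (c : 'I_d -> R)
    (v : 'I_d -> 'rV[R]_3 -> 'rV[R]_3) :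
  beltrami Omega l u -> (forall k, beltrami Omega l (v k)) ->
  beltrami Omega l (fun x => a *: u x + \sum_k c k *: v k x).
Proof.
move=> bu bv.
have E s : beltrami Omega l (fun x => \sum_(k <- s) c k *: v k x).
  elim: s => [|k s IH].
    rewrite (_ : (fun x => _) = (fun x => 0 *: u x + 0 *: u x)).
      exact: (beltrami_linear hOmega).
    by apply/funext => x; rewrite big_nil !scale0r addr0.
  rewrite (_ : (fun x => _) =
     (fun x => c k *: v k x + 1 *: \sum_(i <- s) c i *: v i x)).
    exact: (beltrami_linear hOmega).
  by apply/funext => x; rewrite big_cons scale1r.
rewrite (_ : (fun x => _) =
     (fun x => a *: u x + 1 *: \sum_i c i *: v i x)).
  exact: (beltrami_linear hOmega).
by apply/funext => x; rewrite scale1r.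
Qed.

Lemma smooth_harmonic_field : smoothc (@harmonic_field R).
Proof. by have [] := beltrami_harmonic_field hOmega. Qed.

(** The Gram matrix of the eigenbasis is invertible: the inner product is
    definite on smooth fields, so a vector in its kernel gives a vanishing
    combination of the basis. *)
Lemma eigenbasis_projection d l (v : 'I_d -> 'rV[R]_3 -> 'rV[R]_3) u :
  eigenbasis Omega l v -> smoothc u ->
  exists c : 'I_d -> R, forall k,
    ip (fun x => u x + \sum_j c j *: v j x) (v k) = 0.
Proof.
move=> [ev _ fv] su.
have sv k : smoothc (v k) by have [[]] := ev k.
pose G := \matrix_(i, j) ip (v i) (v j).
have uG : G \in unitmx.
  rewrite unitmxE unitfE; apply/negP => /det0P [a a0 aG].
  pose S x := \sum_k a 0 k *: v k x.
  have sS : smoothc S.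
    by apply: smooth_sum => k; apply: smoothZ => //; exact: smooth_cst.
  have SE w : smoothc w -> ip S w = \sum_k a 0 k * ip (v k) w.
    move=> sw; have := ip_lincomb 0 (a 0) su sv sw; rewrite mul0r add0r => <-.
    by congr ip; apply/funext => x; rewrite scale0r add0r.
  have Sv k : ip S (v k) = 0.
    rewrite SE//; transitivity ((a *m G) 0 k); last by rewrite aG mxE.
    by rewrite mxE; apply: eq_bigr => i _; rewrite mxE.
  have S0 : forall x, Omega x -> S x = 0.
    apply: ip_eq0 => //; rewrite SE// big1// => k _.
    by rewrite ip_sym Sv mulr0.
  move/eqP: a0; apply; apply/rowP => k; rewrite mxE; move: k; apply: fv.
  apply: (@smooth_eq_on_closure _ S (fun=> 0)) => //; exact: smooth_cst.
have [b bG] : exists b : 'rV[R]_d, b *m G = - \row_k ip u (v k).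
  by exists ((- \row_k ip u (v k)) *m invmx G); rewrite mulmxKV.
exists (fun k => b 0 k) => k.
have := ip_lincomb 1 (fun k => b 0 k) su sv (sv k); rewrite mul1r => E.
rewrite (_ : (fun x => _) = (fun x => 1 *: u x + \sum_j b 0 j *: v j x)); last first.
  by apply/funext => x; rewrite scale1r.
rewrite E; apply/eqP; rewrite addrC addr_eq0; apply/eqP.
transitivity ((b *m G) 0 k); last by rewrite bG !mxE.
by rewrite mxE; apply: eq_bigr => i _; rewrite mxE.
Qed.

(** If the flux c of B does not vanish, then projecting B / c away from the
    eigenfields leaves a unit-flux solution, so that V is one. As B - c V has no
    flux, it is an eigenfield. *)
Lemma eigenvalue_decomposition l d (v : 'I_d -> 'rV[R]_3 -> 'rV[R]_3)
    (V B : 'rV[R]_3 -> 'rV[R]_3) :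
  eigenbasis Omega l v ->
  ((exists W, unit_flux_solution Omega l v W) -> unit_flux_solution Omega l v V) ->
  beltrami Omega l B ->
  exists (c0 : R) (c : 'I_d -> R), forall x, closure Omega x ->
    B x = c0 *: V x + \sum_k c k *: v k x.
Proof.
move=> bv hV bB; have [ev spanv _] := bv.
have sv k : smoothc (v k) by have [[]] := ev k.
have sB : smoothc B by case: bB.
have sh := smooth_harmonic_field.
have vh k : ip (v k) (@harmonic_field R) = 0.
  by have [_ E] := ev k; rewrite /ip E.
have [B0|Bn0] := eqVneq (ip B (@harmonic_field R)) 0.
  have [|c Bc] := spanv B; first by split=> //; rewrite ipE// B0.
  by exists 0, c => x cx; rewrite scale0r add0r Bc.
set c := ip B _ in Bn0.
have [a aP] := eigenbasis_projection bv (u := fun x => c^-1 *: B x)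
  (smoothZ (smooth_cst _ _) sB).
pose W x := c^-1 *: B x + \sum_k a k *: v k x.
have uV : unit_flux_solution Omega l v V.
  apply: hV; exists W.
  have bW : beltrami Omega l W.
    by apply: beltrami_lincomb => // k; have [] := ev k.
  have sW : smoothc W by case: bW.
  split=> // [k|]; first by rewrite ipE// aP.
  rewrite ipE// ip_lincomb// big1 => [|k _]; last by rewrite vh mulr0.
  by rewrite addr0 mulVf.
have [bV _ VhE] := uV.
have sV : smoothc V by case: bV.
have Vh : ip V (@harmonic_field R) = 1 by rewrite /ip VhE.
have [|e Be] := spanv (fun x => 1 *: B x + (- c) *: V x).
  split; first exact: (beltrami_linear hOmega).
  rewrite ipE//; first by rewrite ip_linear// Vh -/c mul1r mulr1 subrr.
  by apply: smoothD; apply: smoothZ => //; exact: smooth_cst.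
exists c, e => x cx; rewrite -Be// scale1r scaleNr.
by rewrite addrC subrK.
Qed.

(** Otherwise a Beltrami field for l is determined by its flux, and all of them
    are multiples of B. Depending on whether l vanishes, compare B with the
    harmonic field or with its own rotations; both times B is orthogonal to
    grad r^2, and r^2 is a first integral that is not constant. *)
Lemma beltrami_eigenvalue l (B : 'rV[R]_3 -> 'rV[R]_3) : beltrami Omega l B ->
  (forall x, Omega x -> B x != 0) ->
  (forall P, smoothc P -> (forall x, Omega x -> dot (B x) (grad P x) = 0) ->
    forall x y, closure Omega x -> closure Omega y -> P x = P y) ->
  exists v, curl_eigenfield Omega l v /\ exists x, Omega x /\ v x != 0.
Proof.
move=> bB B0 fi; apply: contrapT => nE.
have sB : smoothc B by case: bB.
have sh := smooth_harmonic_field.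
have eig0 v : curl_eigenfield Omega l v -> forall x, Omega x -> v x = 0.
  move=> ev x Ox; apply/eqP; apply: contrapT => /negP vx; apply: nE.
  by exists v; split=> //; exists x.
set Phi := ip B (@harmonic_field R).
have Phi0 : Phi != 0.
  apply/eqP => P0; have [x Ox] := Omega_nonempty hOmega.
  move/eqP: (B0 x Ox); apply; apply: eig0 Ox.
  by split=> //; rewrite ipE// -/Phi P0.
have proportional C : beltrami Omega l C -> exists k : R, forall x, Omega x -> C x = k *: B x.
  move=> bC; have sC : smoothc C by case: bC.
  exists (ip C (@harmonic_field R) / Phi) => x Ox.
  set k := _ / Phi.
  have /eig0 /(_ x Ox) : curl_eigenfield Omega l (fun x => 1 *: C x + (- k) *: B x).
    split; first exact: (beltrami_linear hOmega).
    rewrite ipE//; last by apply: smoothD; apply: smoothZ => //; exact: smooth_cst.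
    by rewrite ip_linear// -/Phi mul1r mulNr divfK// subrr.
  by rewrite scale1r scaleNr => /eqP; rewrite subr_eq0 => /eqP.
suff rB x : Omega x -> dot (B x) (grad (@rsq R) x) = 0.
  apply: (rsq_not_constant hOmega); apply: fi rB; exact: smooth_rsq.
have [l0|ln0] := eqVneq l 0.
  move=> Ox; have bh := beltrami_harmonic_field hOmega.
  rewrite -l0 in bh; have [k kB] := proportional _ bh.
  have r0 := rsq_gt0 hOmega (OcO Ox).
  have hr : dot (harmonic_field x) (grad (@rsq R) x) = 0.
    rewrite /harmonic_field dotZl grad_rsq dot3 /d_theta !vec3E.
    by rewrite [X in _ * X](_ : _ = 0) ?mulr0//; ring.
  have k0 : k != 0.
    apply/eqP => k0; have := kB x Ox; rewrite k0 scale0r /harmonic_field => /eqP.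
    rewrite scaler_eq0 invr_eq0 gt_eqF//= => /eqP /rowP h.
    move: (h 0) (h 1) r0; rewrite /d_theta !vec3E !mxE /rsq => /eqP.
    by rewrite oppr_eq0 => /eqP -> ->; rewrite expr0n addr0 ltxx.
  move: hr; rewrite kB// dotZl => /eqP; rewrite mulf_eq0 (negbTE k0) /=.
  by move/eqP.
have kap t : exists k : R, forall x, Omega x -> rotated_field t B x = k *: B x.
  by apply: proportional; exact: beltrami_rotated.
have O t y : Omega y -> Omega (rot t y) := @Omega_rot _ _ hOmega t y.
pose q y := dot (B y) (B y).
have sq : smoothc q by exact: smooth_dot.
have qk t k : (forall x, Omega x -> rotated_field t B x = k *: B x) ->
    forall y, Omega y -> q (rot t y) = k ^+ 2 * q y.
  move=> kB y Oy; rewrite /q -(dot_rot (- t)) -/(rotated_field t B y) kB//.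
  by rewrite dotZl dotZr mulrA expr2.
have q0 y : Omega y -> 0 < q y.
  by move=> Oy; rewrite lt_def dot_ge0 andbT dot_eq0 B0.
(* |B| attains its maximum, and a rotation multiplies |B|^2 by k ^+ 2; the
   opposite rotation divides it by the same factor. *)
have [z cz zmax] := smooth_max sq.
have qz : 0 < q z.
  have [y Oy] := Omega_nonempty hOmega.
  exact: lt_le_trans (q0 y Oy) (zmax y (OcO Oy)).
have kle1 t k : (forall x, Omega x -> rotated_field t B x = k *: B x) ->
    k ^+ 2 <= 1.
  move=> kB.
  have qr : smoothc (fun y => q (rot t y)).
    by apply: (smooth_comp _ (smooth_rot _ t) sq) => y; exact: closure_rot.
  have qs : smoothc (fun y => k ^+ 2 * q y).
    by apply: smoothM => //; exact: smooth_cst.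
  have E := smooth_eq_on_closure qr qs (qk t k kB) cz.
  have := zmax _ (closure_rot hOmega (t := t) cz).
  by rewrite E ger_pMl.
have keq1 t k : (forall x, Omega x -> rotated_field t B x = k *: B x) ->
    k ^+ 2 = 1.
  move=> kB; have [k' kB'] := kap (- t).
  have k1 := kle1 _ _ kB; have k1' := kle1 _ _ kB'.
  have [y Oy] := Omega_nonempty hOmega.
  have := qk _ _ kB' _ (O t _ Oy); rewrite rotK (qk _ _ kB)// => qE.
  have {}qE : 1 = k' ^+ 2 * k ^+ 2.
    by apply: (mulIf (lt0r_neq0 (q0 y Oy))); rewrite mul1r -mulrA.
  apply/eqP; rewrite eq_le k1 /= [leLHS]qE -[leRHS]mul1r.
  by rewrite ler_wpM2r// sqr_ge0.
(* The factor for t is the square of the factor for t / 2, which is 1 or -1. *)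
have symB t y : Omega y -> rotated_field t B y = B y.
  move=> Oy; have [k kB] := kap (t / 2).
  have tE : t = t / 2 + t / 2 by rewrite -splitr.
  rewrite /rotated_field {2}tE rotD [in - t]tE opprD rotD.
  rewrite -/(rotated_field (t / 2) B (rot (t / 2) y)) kB; last exact: O.
  have := rotZD (- (t / 2)) k (B (rot (t / 2) y)) 0; rewrite !addr0 => ->.
  rewrite (_ : rot _ 0 = 0); last by apply/eqP; rewrite rot_eq0.
  rewrite addr0 -/(rotated_field (t / 2) B y) kB// scalerA -expr2.
  by rewrite (keq1 _ _ kB) scale1r.
move=> Ox; apply: (axisymmetric_beltrami_toroidal hOmega bB symB ln0) => //.
apply: fi; first exact: (smooth_axial_momentum bB).
exact: (axial_momentum_first_integral hOmega bB symB).
Qed.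

End spectral.

(** * Equilibria *)

(* The eigenvalues are indexed from 0.  For each j, V j is the solution of the
   unit-flux problem whenever that problem is solvable. *)
Theorem theorem2p7 (R : realType) (Omega : set 'rV[R]_3)
  (hOmega : toroidal_domain Omega)
  (J : ('rV[R]_3 -> 'rV[R]_3) -> ('rV[R]_2 -> 'rV[R]_2))
  (hJ : mu_preserving_poincare Omega J)
  (lambda : nat -> R) (hlambda : curl_spectrum Omega lambda)
  (d : nat -> nat) (v : forall j : nat, 'I_(d j) -> 'rV[R]_3 -> 'rV[R]_3)
  (hv : forall j, eigenbasis Omega (lambda j) (v j))
  (V : nat -> 'rV[R]_3 -> 'rV[R]_3)
  (hV : forall j, (exists W, unit_flux_solution Omega (lambda j) (v j) W) ->
                  unit_flux_solution Omega (lambda j) (v j) (V j))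
  (B : 'rV[R]_3 -> 'rV[R]_3) (hB : braided Omega B)
  (hJB : U_NI (section Omega) (J B))
  (Y : 'rV[R]_3 -> 'rV[R]_3) (hY : volume_preserving_diffeo Omega Y)
  (Bbar : 'rV[R]_3 -> 'rV[R]_3) (hBbar : field_pushforward Omega Y B Bbar)
  (hMHS : mhs_equilibrium Omega Bbar) :
  exists (j : nat) (c0 : R) (c : 'I_(d j) -> R),
    forall x, closure Omega x ->
      Bbar x = c0 *: V j x + \sum_k c k *: v j k x.
Proof.
have [dY _] := hY.
have fi := pushforward_first_integral_constant hOmega hB dY hBbar hJ hJB.
have B0 := pushforward_neq0 hOmega hB dY hBbar.
have [sBbar _] := hBbar.
have [l bB] := mhs_beltrami hOmega hMHS sBbar B0 fi.
have [_ _ spec] := hlambda.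
have [j lj] : exists j, l = lambda j.
  apply/spec; apply: (beltrami_eigenvalue hOmega bB) => // x Ox.
  by apply: B0; exact: subset_closure.
exists j; rewrite lj in bB.
exact: (eigenvalue_decomposition hOmega (hv j) (@hV j) bB).
Qed.
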